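(* Let $\mathcal{G}=(X,i_1,i_2,\ldots,i_k,\mu)$ be a measurable graphing (whose leafgraph has all degrees at most $\Delta$). Then the law $\Psi(\mathcal{G})$ of $\mathcal{G}$ is a unimodular measure on $\mathbf{Gr}$.
   Context: Fix a positive integer $\Delta$. All graphs are simple and undirected; $\mathbb{N}=\{0,1,2,\dots\}$. For a graph $G$, $N_G(o)$ is the set of vertices adjacent to $o$, and $B_G(o,r)$ is the subgraph induced by the vertices at graph distance at most $r$ from $o$ (within the connected component of $o$). A rooted graph is a pair $(G,o)$ with $o\in V(G)$; a birooted graph is a triple $(G,o_1,o_2)$ with $o_1\in V(G)$, $o_2\in N_G(o_1)$; isomorphisms must preserve the roots (in order). $\mathbf{Gr}$ is the set of isomorphism classes $[G,o]$ of countable connected rooted graphs with all degrees at most $\Delta$, with the metric $\rho([G,o],[H,p])=0$ if $[G,o]=[H,p]$ and $2^{-r}$ otherwise, where $r=\sup\{s\in\mathbb{N}: [B_G(o,s),o]=[B_H(p,s),p]\}$. $\vec{\mathbf{Gr}}$ is the set of isomorphism classes $[G,o_1,o_2]$ of countable connected birooted graphs with all degrees at most $\Delta$, with the metric $\vec\rho([G,o_1,o_2],[H,p_1,p_2])=0$ if the classes are equal and $2^{-r}$ otherwise, where $r=\sup\{s\in\mathbb{N}: [B_G(o_1,s),o_1,o_2]=[B_H(p_1,s),p_1,p_2]\}$ (the condition for $s=0$ is regarded as always satisfied). Both are compact ultrametric spaces, equipped with their Borel $\sigma$-algebras. A probability measure $\mu$ on $\mathbf{Gr}$ is unimodular if $$\int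 \sum_{x\in N_G(o)} f[G,x,o]\,d\mu[G,o]=\int \sum_{x\in N_G(o)} f[G,o,x]\,d\mu[G,o]$$ for all nonnegative real-valued Borel functions $f$ on $\vec{\mathbf{Gr}}$. A measurable graphing is a tuple $\mathcal{G}=(X,i_1,\ldots,i_k,\mu)$ where $X$ is a (standard) Borel space, $\mu$ is a probability measure on $X$, and each $i_j:X\to X$ is a measure-preserving Borel involution. Its leafgraph $\mathcal{L}$ is the (simple) graph with vertex set $X$ in which distinct $x,y$ are adjacent precisely when $y=i_j(x)$ for some $j$. A rooted $r$-ball is an element $[G,o]\in\mathbf{Gr}$ with $d_G(x,o)\le r$ for all $x\in V(G)$; $U_r$ is the set of rooted $r$-balls; for $\alpha\in U_r$, $T_r(\mathbf{Gr},\alpha)=\{[G,o]\in\mathbf{Gr}: [B_G(o,r),o]=\alpha\}$. The law of $\mathcal{G}$ is the Borel probability measure $\Psi(\mathcal{G})$ on $\mathbf{Gr}$ determined by $\Psi(\mathcal{G})(T_r(\mathbf{Gr},\alpha))=\mu(\{x\in X: [B_{\mathcal{L}}(x,r),x]=\alpha\})$ for all $r\in\mathbb{N}$, $\alpha\in U_r$. *)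

(* Defs.v *)
From HB Require Import structures.
From mathcomp Require Import all_boot all_order all_algebra.
From mathcomp Require Import all_classical all_reals all_analysis.

Set Implicit Arguments.
Unset Strict Implicit.
Unset Printing Implicit Defensive.

Import Order.TTheory GRing.Theory Num.Theory.

Local Open Scope classical_set_scope.
Local Open Scope ring_scope.

Record graph (T : Type) := Graph {
  vert : set T;
  adj : rel T;
  adj_sym : symmetric adj;
  adj_irr : irreflexive adj;
  adj_vert : forall x y, adj x y -> vert x }.

Section graph_defs.
Variables (T : Type) (G : graph T).

Definition nbrs (x : T) : set T := [set y | adj G x y].

Definition max_degree_le (D : nat) :=
  forall x, vert G x -> (nbrs x #<= `I_D)%card.

(* [y] lies in the component of [x], at graph distance at most [n] from [x] *)
Definition dist_le (n : nat) (x y : T) :=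
  exists p : seq T, [/\ path (adj G) x p, last x p = y & (size p <= n)%N].

Definition connected_graph :=
  forall x y, vert G x -> vert G y -> exists n, dist_le n x y.

Definition induced_adj (A : set T) : rel T :=
  fun x y => [&& adj G x y, x \in A & y \in A].

Lemma induced_adj_sym A : symmetric (induced_adj A).
Proof. by move=> x y; rewrite /induced_adj adj_sym (andbC (x \in A)). Qed.

Lemma induced_adj_irr A : irreflexive (induced_adj A).
Proof. by move=> x; rewrite /induced_adj adj_irr. Qed.

Lemma induced_adj_vert A x y : induced_adj A x y -> (vert G `&` A) x.
Proof.
by move=> /and3P[xy /set_mem Ax _]; split=> //; exact: adj_vert xy.
Qed.

Definition induced (A : set T) : graph T :=
  Graph (@induced_adj_sym A) (@induced_adj_irr A) (@induced_adj_vert A).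

Definition gball (o : T) (r : nat) : graph T := induced [set x | dist_le r o x].

End graph_defs.

Section isomorphisms.
Variables (T T' : Type) (G : graph T) (H : graph T').

Definition graph_iso (f : T -> T') :=
  set_bij (vert G) (vert H) f /\
  forall x y, vert G x -> vert G y -> adj H (f x) (f y) = adj G x y.

Definition rooted_iso (o : T) (p : T') := exists2 f, graph_iso f & f o = p.

Definition birooted_iso (o1 o2 : T) (p1 p2 : T') :=
  exists2 f, graph_iso f & f o1 = p1 /\ f o2 = p2.

End isomorphisms.

Lemma graph_iso_id (T : Type) (G : graph T) : graph_iso G G id.
Proof. by split=> //; split=> [x|x y|x] //= Gx; exists x. Qed.

Lemma graph_iso_comp (T1 T2 T3 : Type) (G : graph T1) (H : graph T2)
    (K : graph T3) f g :
  graph_iso G H f -> graph_iso H K g -> graph_iso G K (g \o f).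
Proof.
move=> [[fGH finj fsurj] fadj] [[gHK ginj gsurj] gadj]; split; last first.
  by move=> x y Gx Gy /=; rewrite gadj ?fadj//; exact: fGH.
split=> [x Gx|x y /set_mem Gx /set_mem Gy /= gfxy|z Kz] /=.
- exact/gHK/fGH.
- apply: finj; rewrite ?inE//; apply: ginj => //; rewrite inE; exact: fGH.
- have [y Hy <-] := gsurj _ Kz; have [x Gx <-] := fsurj _ Hy.
  by exists x.
Qed.

Lemma graph_iso_inv (T T' : Type) (G : graph T) (H : graph T') f (o : T) :
  graph_iso G H f -> exists2 g, graph_iso H G g &
    forall x, vert G x -> g (f x) = x.
Proof.
move=> [[fGH finj fsurj] fadj].
have /choice[g gP] : forall y, exists x, vert H y -> vert G x /\ f x = y.
  move=> y; have [Hy|nHy] := pselect (vert H y); last by exists o.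
  by have [x Gx <-] := fsurj _ Hy; exists x.
have gf x : vert G x -> g (f x) = x.
  move=> Gx; have [Ggfx fgfx] := gP _ (fGH _ Gx).
  by apply: finj; rewrite ?inE.
exists g => //; split; first split=> [y Hy|x y /set_mem Hx /set_mem Hy gxy|x Gx].
- by have [] := gP _ Hy.
- by have [_ <-] := gP _ Hx; have [_ <-] := gP _ Hy; rewrite gxy.
- by exists (f x); [exact: fGH|exact: gf].
- move=> x y Hx Hy; have [Gx fx] := gP _ Hx; have [Gy fy] := gP _ Hy.
  by rewrite -{2}fx -{2}fy fadj.
Qed.

Section iso_equivalence.
Variables T1 T2 T3 : Type.

Lemma rooted_iso_refl (G : graph T1) o : rooted_iso G G o o.
Proof. by exists id => //; exact: graph_iso_id. Qed.

Lemma rooted_iso_sym (G : graph T1) (H : graph T2) o p : vert G o ->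
  rooted_iso G H o p -> rooted_iso H G p o.
Proof.
move=> Go [f isof <-]; have [g isog gf] := graph_iso_inv o isof.
by exists g => //; exact: gf.
Qed.

Lemma rooted_iso_trans (G : graph T1) (H : graph T2) (K : graph T3) o p q :
  rooted_iso G H o p -> rooted_iso H K p q -> rooted_iso G K o q.
Proof.
move=> [f isof <-] [g isog <-]; exists (g \o f) => //.
exact: graph_iso_comp isof isog.
Qed.

Lemma birooted_iso_refl (G : graph T1) o1 o2 : birooted_iso G G o1 o2 o1 o2.
Proof. by exists id => //; exact: graph_iso_id. Qed.

Lemma birooted_iso_sym (G : graph T1) (H : graph T2) o1 o2 p1 p2 :
  vert G o1 -> vert G o2 ->
  birooted_iso G H o1 o2 p1 p2 -> birooted_iso H G p1 p2 o1 o2.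
Proof.
move=> Go1 Go2 [f isof [<- <-]]; have [g isog gf] := graph_iso_inv o1 isof.
by exists g => //; split; exact: gf.
Qed.

Lemma birooted_iso_trans (G : graph T1) (H : graph T2) (K : graph T3)
    o1 o2 p1 p2 q1 q2 :
  birooted_iso G H o1 o2 p1 p2 -> birooted_iso H K p1 p2 q1 q2 ->
  birooted_iso G K o1 o2 q1 q2.
Proof.
move=> [f isof [<- <-]] [g isog [<- <-]]; exists (g \o f) => //.
exact: graph_iso_comp isof isog.
Qed.

End iso_equivalence.

Section balls.

Lemma dist_le0 (T : Type) (G : graph T) o : dist_le G 0 o o.
Proof. by exists [::]. Qed.

Lemma dist_le_widen (T : Type) (G : graph T) m n o x : (m <= n)%N ->
  dist_le G m o x -> dist_le G n o x.
Proof. by move=> mn [p [op px pm]]; exists p; split=> //; exact: leq_trans mn. Qed.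

Lemma dist_leS (T : Type) (G : graph T) n o x y :
  dist_le G n o x -> adj G x y -> dist_le G n.+1 o y.
Proof.
move=> [p [op px pm]] xy; exists (rcons p y).
by rewrite rcons_path last_rcons size_rcons px op.
Qed.

Lemma dist_leSP (T : Type) (G : graph T) n o y : dist_le G n.+1 o y ->
  dist_le G n o y \/ exists2 x, dist_le G n o x & adj G x y.
Proof.
move=> [p]; case/lastP: p => [|p z] [op py pn].
  by left; exists [::].
move: op py pn; rewrite rcons_path last_rcons size_rcons => /andP[op pz] <- pn.
by right; exists (last o p) => //; exists p.
Qed.

Lemma gball_vert_root (T : Type) (G : graph T) o r :
  vert G o -> vert (gball G o r) o.
Proof. by move=> Go; split=> //; apply: dist_le_widen (dist_le0 G o). Qed.

Lemma gball_vert_widen (T : Type) (G : graph T) o m n x : (m <= n)%N ->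
  vert (gball G o m) x -> vert (gball G o n) x.
Proof. by move=> mn [Gx xm]; split=> //; exact: dist_le_widen xm. Qed.

Lemma gball_adj (T : Type) (G : graph T) o r x y :
  vert (gball G o r) x -> vert (gball G o r) y ->
  adj (gball G o r) x y = adj G x y.
Proof.
by move=> [_ xr] [_ yr]; rewrite /= /induced_adj !mem_set ?andbT.
Qed.

Lemma gball_iso_dist (T T' : Type) (G : graph T) (H : graph T') o p s t f :
  vert G o -> (t <= s)%N ->
  graph_iso (gball G o s) (gball H p s) f -> f o = p ->
  forall x, vert (gball G o t) x -> vert (gball H p t) (f x).
Proof.
move=> Go ts [[fGH _ _] fadj] fo x [Gx xt].
have {Gx}Hs y : vert (gball G o s) y -> vert H (f y) by move=> /fGH[].
split.
  apply: Hs; split; last exact: dist_le_widen xt.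
  case: xt => q; case/lastP: q => [[_ <-//]|q z].
  rewrite rcons_path last_rcons => -[/andP[_ qz] <- _].
  by move: qz; rewrite adj_sym; exact: adj_vert.
elim: t ts x xt => [|t IH] ts x /=.
  by move=> [[|z q] [_ <- //= _]]; rewrite fo; exact: dist_le0.
move=> xt; case: (dist_leSP xt) => [xt'|[y yt yx]].
  by apply: dist_le_widen (leqnSn t) _; apply: IH => //; exact: ltnW.
apply: (dist_leS (IH (ltnW ts) _ yt)).
have sx : vert (gball G o s) x.
  by split; [move: yx; rewrite adj_sym; exact: adj_vert|exact: dist_le_widen xt].
have sy : vert (gball G o s) y.
  by split; [exact: adj_vert yx|exact: dist_le_widen (ltnW ts) yt].
by rewrite -(gball_adj (fGH _ sy) (fGH _ sx)) fadj// gball_adj.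
Qed.

Lemma gball_iso_restr (T T' : Type) (G : graph T) (H : graph T') o p s t f :
  vert G o -> (t <= s)%N ->
  graph_iso (gball G o s) (gball H p s) f -> f o = p ->
  graph_iso (gball G o t) (gball H p t) f.
Proof.
move=> Go ts isof fo; have [[fGH finj fsurj] fadj] := isof.
have [g isog gf] := graph_iso_inv o isof.
have gp : g p = o by rewrite -fo gf//; exact: gball_vert_root.
have Hp : vert H p by have [] := fGH _ (gball_vert_root s Go); rewrite fo.
have st x : vert (gball G o t) x -> vert (gball G o s) x.
  exact: gball_vert_widen.
split; last first.
  move=> x y tx ty.
  rewrite !gball_adj//; try exact: (gball_iso_dist _ ts isof).
  by rewrite -[RHS](gball_adj (st _ tx) (st _ ty)) -fadj; [
     rewrite gball_adj//; apply: fGH; exact: st|exact: st|exact: st].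
split=> [x|x y /set_mem tx /set_mem ty|y ty].
- exact: (gball_iso_dist _ ts isof).
- by apply: finj; rewrite inE; exact: st.
- have [x sx fx] := fsurj _ (gball_vert_widen ts ty).
  by exists x => //; rewrite -(gf _ sx) fx; exact: (gball_iso_dist _ ts isog).
Qed.

End balls.

(* Every countable graph is isomorphic to one whose vertices form a subset of
   [nat]. *)
Record cgraph (D : nat) := CGraph {
  cg :> graph nat;
  cg_connected : connected_graph cg;
  cg_degree : max_degree_le cg D }.

Record rgraph (D : nat) := RGraph {
  rg :> cgraph D;
  root : nat;
  root_vert : vert rg root }.

Record brgraph (D : nat) := BRGraph {
  brg :> cgraph D;
  root1 : nat;
  root2 : nat;
  roots_adj : adj brg root1 root2 }.

HB.instance Definition _ D := gen_eqMixin (rgraph D).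
HB.instance Definition _ D := gen_choiceMixin (rgraph D).
HB.instance Definition _ D := gen_eqMixin (brgraph D).
HB.instance Definition _ D := gen_choiceMixin (brgraph D).

Lemma root1_vert D (G : brgraph D) : vert G (root1 G).
Proof. exact: adj_vert (roots_adj G). Qed.

Lemma root2_vert D (G : brgraph D) : vert G (root2 G).
Proof. by apply: (@adj_vert _ _ _ (root1 G)); rewrite adj_sym roots_adj. Qed.

Definition rgraph_iso D : rel (rgraph D) :=
  fun G H => `[< rooted_iso G H (root G) (root H) >].

Definition brgraph_iso D : rel (brgraph D) :=
  fun G H => `[< birooted_iso G H (root1 G) (root2 G) (root1 H) (root2 H) >].

Lemma rgraph_iso_equiv D : equiv_class_of (@rgraph_iso D).
Proof.
split=> [G|G H|H G K].
- by apply/asboolP; exact: rooted_iso_refl.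
- by apply: asbool_equiv_eq; split; apply: rooted_iso_sym; exact: root_vert.
- by move=> /asboolP GH /asboolP HK; apply/asboolP; exact: rooted_iso_trans HK.
Qed.

Lemma brgraph_iso_equiv D : equiv_class_of (@brgraph_iso D).
Proof.
split=> [G|G H|H G K].
- by apply/asboolP; exact: birooted_iso_refl.
- by apply: asbool_equiv_eq; split; apply: birooted_iso_sym;
    (exact: root1_vert || exact: root2_vert).
- by move=> /asboolP GH /asboolP HK; apply/asboolP; exact: birooted_iso_trans HK.
Qed.

Canonical rgraph_iso_equivRel D := EquivRelPack (@rgraph_iso_equiv D).
Canonical brgraph_iso_equivRel D := EquivRelPack (@brgraph_iso_equiv D).

(* [R] only serves to infer the field in which the metric takes its values;
   the proof of [0 < D] makes [vGr] nonempty, as required of the carrier of a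
   [measurableType]. *)
Definition Gr (R : realType) (D : nat) : Type :=
  {eq_quot (@rgraph_iso D)}%qT.

Definition vGr (R : realType) (D : nat) (D0 : (0 < D)%N) : Type :=
  {eq_quot (@brgraph_iso D)}%qT.

HB.instance Definition _ R D := Choice.on (Gr R D).
HB.instance Definition _ R D := EqQuotient.on (Gr R D).
HB.instance Definition _ R D (D0 : (0 < D)%N) := Choice.on (vGr R D0).
HB.instance Definition _ R D (D0 : (0 < D)%N) := EqQuotient.on (vGr R D0).

Section agreement_metric.
Variables (R : realType) (Q : choiceType) (agree : Q -> Q -> set nat).

Definition agree_radius (x y : Q) : \bar R :=
  ereal_sup [set s%:R%:E | s in agree x y].

(* The convention [2 ^ - oo = 0] is never used for [Gr] and [vGr]: by local
   finiteness, two distinct classes have a finite agreement radius. *)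
Definition agree_dist (x y : Q) : R :=
  if x == y then 0 else
  if agree_radius x y is r%:E then 2 `^ (- r) else 0.

Definition agree_ball (x : Q) (e : R) : set Q := [set y | agree_dist x y < e].

Hypothesis agree0 : forall x y, agree x y 0%N.
Hypothesis agree_sym : forall x y, agree x y `<=` agree y x.
Hypothesis agree_trans : forall y x z s, agree x y s -> agree y z s ->
  agree x z s.
Hypothesis agree_le : forall x y s t, (t <= s)%N -> agree x y s -> agree x y t.

Lemma agree_dist_ge0 x y : 0 <= agree_dist x y.
Proof.
by rewrite /agree_dist; case: ifP => // _; case: agree_radius => // r;
  exact: powR_ge0.
Qed.

Lemma agree_dist_lt (e : R) x y : 0 < e -> agree_dist x y < e <->
  x = y \/ exists2 s, agree x y s & - (ln e / ln 2) < s%:R.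
Proof.
move=> e0; rewrite /agree_dist; have [->|xy] := eqVneq x y.
  by split=> // _; left.
have ln2 : 0 < ln 2 :> R by rewrite ln_gt0// ltr1n.
transitivity ((- (ln e / ln 2))%:E < agree_radius x y)%E; last first.
  split=> [/ereal_sup_gt[_ [s xys <-]]|[/eqP|[s xys ltes]]].
  - by rewrite lte_fin => ltes; right; exists s.
  - by rewrite (negPf xy).
  - apply: (@lt_le_trans _ _ s%:R%:E); first by rewrite lte_fin.
    by apply: ereal_sup_ubound; exists s.
have : (0 <= agree_radius x y)%E by apply: ereal_sup_ubound; exists 0%N.
case: agree_radius => [r _||//]; last by rewrite ltry.
rewrite lte_fin -(@ltr_ln R) ?posrE ?powR_gt0// ln_powR.
by rewrite -ltr_pdivlMr// ltrNl.
Qed.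

Lemma agree_ball_center x (e : R) : 0 < e -> agree_ball x e x.
Proof. by move=> e0; apply/(agree_dist_lt _ _ e0); left. Qed.

Lemma agree_ball_gt0 x y (e : R) : agree_ball x e y -> 0 < e.
Proof. exact/le_lt_trans/agree_dist_ge0. Qed.

Lemma agree_ball_sym x y (e : R) : agree_ball x e y -> agree_ball y e x.
Proof.
move=> xy; have e0 := agree_ball_gt0 xy; move: xy.
move=> /(agree_dist_lt _ _ e0)[->|[s xys es]]; first exact: agree_ball_center.
by apply/(agree_dist_lt _ _ e0); right; exists s => //; exact: agree_sym.
Qed.

Lemma agree_ball_triangle x y z (e1 e2 : R) :
  agree_ball x e1 y -> agree_ball y e2 z -> agree_ball x (e1 + e2) z.
Proof.
move=> xy yz; have e10 := agree_ball_gt0 xy; have e20 := agree_ball_gt0 yz.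
have [e1e e2e] : e1 <= e1 + e2 /\ e2 <= e1 + e2.
  by rewrite lerDl lerDr !ltW.
have ball_le u v (a b : R) : a <= b -> agree_ball u a v -> agree_ball u b v.
  by move=> ab uv; exact: lt_le_trans ab.
move: (xy) (yz) => /(agree_dist_lt _ _ e10)[->|[s xys es]].
  by move=> _; exact: ball_le yz.
move=> /(agree_dist_lt _ _ e20)[<-|[t yzt et]]; first exact: ball_le xy.
have [st|ts] := leqP s t.
  apply: ball_le e1e _; apply/(agree_dist_lt _ _ e10); right; exists s => //.
  by apply: agree_trans xys _; exact: agree_le yzt.
apply: ball_le e2e _; apply/(agree_dist_lt _ _ e20); right; exists t => //.
by apply: agree_trans yzt; exact: agree_le (ltnW ts) xys.
Qed.

End agreement_metric.

Section Gr_metric.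
Variables (R : realType) (D : nat).

Definition Gr_agree (g h : Gr R D) : set nat :=
  let G := repr g in let H := repr h in
  [set s | rooted_iso (gball G (root G) s) (gball H (root H) s)
                      (root G) (root H)].

Definition Gr_dist : Gr R D -> Gr R D -> R := agree_dist R Gr_agree.

Lemma Gr_agree0 g h : Gr_agree g h 0%N.
Proof.
rewrite /Gr_agree; move: (repr g) (repr h) => G H.
have ball0 (K : rgraph D) x : vert (gball K (root K) 0) x -> x = root K.
  by move=> [_ [[|? ?] [_ //= <-]]].
exists (fun=> root H) => //; split; first split.
- by move=> x _; apply: gball_vert_root; exact: root_vert.
- by move=> x y /set_mem /ball0 -> /set_mem /ball0 ->.
- move=> y /ball0 ->; exists (root G) => //.
  by apply: gball_vert_root; exact: root_vert.
- by move=> x y /ball0 -> /ball0 ->; rewrite !adj_irr.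
Qed.

Lemma Gr_agree_sym g h : Gr_agree g h `<=` Gr_agree h g.
Proof.
by move=> s; apply: rooted_iso_sym; apply: gball_vert_root; exact: root_vert.
Qed.

Lemma Gr_agree_trans h g k s : Gr_agree g h s -> Gr_agree h k s ->
  Gr_agree g k s.
Proof. exact: rooted_iso_trans. Qed.

Lemma Gr_agree_le g h s t : (t <= s)%N -> Gr_agree g h s -> Gr_agree g h t.
Proof.
move=> ts [f isof fo]; exists f => //.
exact: (gball_iso_restr (root_vert _) ts).
Qed.

Definition Gr_ball : Gr R D -> R -> set (Gr R D) := agree_ball Gr_agree.

HB.instance Definition _ := hasNbhs.Build (Gr R D)
  (nbhs_ (entourage_ Gr_ball)).

HB.instance Definition _ := @Nbhs_isPseudoMetric.Build R (Gr R D)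
  (entourage_ Gr_ball) erefl Gr_ball
  (agree_ball_center Gr_agree0)
  (agree_ball_sym Gr_agree0 Gr_agree_sym)
  (agree_ball_triangle Gr_agree0 Gr_agree_trans Gr_agree_le) erefl.

End Gr_metric.

Section vGr_metric.
Variables (R : realType) (D : nat) (D0 : (0 < D)%N).

Definition vGr_agree (g h : vGr R D0) : set nat :=
  let G := repr g in let H := repr h in
  [set s | s = 0%N \/
    birooted_iso (gball G (root1 G) s) (gball H (root1 H) s)
                 (root1 G) (root2 G) (root1 H) (root2 H)].

Definition vGr_dist : vGr R D0 -> vGr R D0 -> R := agree_dist R vGr_agree.

Lemma vGr_agree0 g h : vGr_agree g h 0%N.
Proof. by left. Qed.

Lemma gball_vert_root2 (G : brgraph D) s : (0 < s)%N ->
  vert (gball G (root1 G) s) (root2 G).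
Proof.
move=> s0; split; first exact: root2_vert.
apply: (dist_le_widen s0); apply: (dist_leS (dist_le0 _ _)).
exact: roots_adj.
Qed.

Lemma vGr_agree_sym g h : vGr_agree g h `<=` vGr_agree h g.
Proof.
move=> [|s] [//|gh]; [by left|by left|right].
apply: birooted_iso_sym gh; last exact: gball_vert_root2.
by apply: gball_vert_root; exact: root1_vert.
Qed.

Lemma vGr_agree_trans h g k s : vGr_agree g h s -> vGr_agree h k s ->
  vGr_agree g k s.
Proof.
by move=> [->|gh] [s0|hk]; [left|left|left|right; exact: birooted_iso_trans hk].
Qed.

Lemma vGr_agree_le g h s t : (t <= s)%N -> vGr_agree g h s -> vGr_agree g h t.
Proof.
move=> ts [s0|[f isof [fo1 fo2]]].
  by left; apply/eqP; rewrite -leqn0 -s0.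
right; exists f => //.
exact: (gball_iso_restr (root1_vert _) ts).
Qed.

Definition vGr_ball : vGr R D0 -> R -> set (vGr R D0) := agree_ball vGr_agree.

HB.instance Definition _ := hasNbhs.Build (vGr R D0)
  (nbhs_ (entourage_ vGr_ball)).

HB.instance Definition _ := @Nbhs_isPseudoMetric.Build R (vGr R D0)
  (entourage_ vGr_ball) erefl vGr_ball
  (agree_ball_center vGr_agree0)
  (agree_ball_sym vGr_agree0 vGr_agree_sym)
  (agree_ball_triangle vGr_agree0 vGr_agree_trans vGr_agree_le) erefl.

End vGr_metric.

Section points.

Definition vertex_graph : graph nat.
Proof. by apply: (@Graph nat [set 0%N] (fun _ _ => false)). Defined.

Lemma vertex_graph_connected : connected_graph vertex_graph.
Proof. by move=> x y -> ->; exists 0%N; exact: dist_le0. Qed.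

Lemma vertex_graph_degree D : max_degree_le vertex_graph D.
Proof.
move=> x _; suff -> : nbrs vertex_graph x = set0 by exact: card_ge0.
by rewrite -subset0 => y.
Qed.

Definition vertex_rgraph (D : nat) : rgraph D :=
  @RGraph D (CGraph vertex_graph_connected (@vertex_graph_degree D)) 0%N erefl.

Definition edge_adj : rel nat := fun x y => (x + y == 1)%N.

Lemma edge_adj_sym : symmetric edge_adj.
Proof. by move=> x y; rewrite /edge_adj addnC. Qed.

Lemma edge_adj_irr : irreflexive edge_adj.
Proof. by move=> x; rewrite /edge_adj addnn; case: x. Qed.

Lemma edge_adj_vert x y : edge_adj x y -> `I_2 x.
Proof. by case: x => [|[|x]]. Qed.

Definition edge_graph : graph nat :=
  Graph edge_adj_sym edge_adj_irr edge_adj_vert.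

Lemma edge_graph_connected : connected_graph edge_graph.
Proof.
move=> x y /= x2 y2; exists 1%N.
have [->|xy] := eqVneq x y; first by exists [::].
exists [:: y]; split=> //=; rewrite andbT.
by case: x x2 xy => [|[|//]]; case: y y2 => [|[|//]].
Qed.

Lemma edge_graph_degree D : (0 < D)%N -> max_degree_le edge_graph D.
Proof.
move=> D0 x x2; have xE : nbrs edge_graph x `<=` [set (1 - x)%N].
  by move=> y /eqP /= <-; rewrite addKn.
apply: (card_le_trans (subset_card_le xE)).
by rewrite (card_le_eql card_set1) card_le_II.
Qed.

Definition edge_brgraph (D : nat) (D0 : (0 < D)%N) : brgraph D :=
  @BRGraph D (CGraph edge_graph_connected (edge_graph_degree D0)) 0%N 1%N erefl.

End points.

HB.instance Definition _ R D :=
  isPointed.Build (Gr R D) (\pi_(Gr R D) (vertex_rgraph D))%qT.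
HB.instance Definition _ R D (D0 : (0 < D)%N) :=
  isPointed.Build (vGr R D0) (\pi_(vGr R D0) (edge_brgraph D0))%qT.

Definition Gr_borel (R : realType) (D : nat) :=
  g_sigma_algebraType (@open (Gr R D)).

Definition vGr_borel (R : realType) (D : nat) (D0 : (0 < D)%N) :=
  g_sigma_algebraType (@open (vGr R D0)).

Section unimodularity.
Variables (R : realType) (D : nat) (D0 : (0 < D)%N).

(* [[G, o, x]], and [[G, x, o]] below, for [x] adjacent to the root [o] *)
Definition out_class (G : rgraph D) (x : nbrs G (root G)) : vGr R D0 :=
  (\pi_(vGr R D0) (BRGraph (set_valP x)))%qT.

Lemma adj_nbr (G : rgraph D) (x : nbrs G (root G)) : adj G (val x) (root G).
Proof. by rewrite adj_sym; exact: set_valP x. Qed.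

Definition in_class (G : rgraph D) (x : nbrs G (root G)) : vGr R D0 :=
  (\pi_(vGr R D0) (BRGraph (adj_nbr x)))%qT.

(* Both sums depend only on the class [g], not on the representative. *)
Definition unimodular (P : probability (Gr_borel R D) R) :=
  forall f : vGr_borel R D0 -> R,
    measurable_fun [set: vGr_borel R D0] f -> (forall a, 0 <= f a) ->
    (\int[P]_g (\sum_(x \in [set: nbrs (repr g) (root (repr g))])
                  f (in_class x))%:E =
     \int[P]_g (\sum_(x \in [set: nbrs (repr g) (root (repr g))])
                  f (out_class x))%:E)%E.

End unimodularity.

(* [X] is isomorphic to the Borel space of a separable complete metric space. *)
Definition standard_borel (R : realType) d (X : measurableType d) :=
  exists Y : completePseudoMetricType R,
    [/\ hausdorff_space Y,
        exists2 S : set Y, countable S & dense S &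
        exists2 phi : X -> Y, bijective phi &
          forall A : set Y, <<s open >> A <-> measurable (phi @^-1` A)].

Record graphing (R : realType) d (X : measurableType d) (k : nat) := Graphing {
  invol : 'I_k -> X -> X;
  gmeas : probability X R;
  graphing_borel : standard_borel R X;
  invol_measurable : forall j, measurable_fun [set: X] (invol j);
  involK : forall j, involutive (invol j);
  invol_preserving : forall j (A : set X), measurable A ->
    gmeas (invol j @^-1` A) = gmeas A }.

Section laws.
Variables (R : realType) (d : measure_display) (X : measurableType d).
Variables (k : nat) (G : graphing R X k).

Definition leaf_adj : rel X :=
  fun x y => `[< x <> y /\ exists j : 'I_k, y = invol G j x >].

Lemma leaf_adj_sym : symmetric leaf_adj.
Proof.
move=> x y; apply: asbool_equiv_eq; split=> -[xy [j e]]; split.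
- exact: nesym.
- by exists j; rewrite e involK.
- exact: nesym.
- by exists j; rewrite e involK.
Qed.

Lemma leaf_adj_irr : irreflexive leaf_adj.
Proof. by move=> x; apply/asboolP => -[]. Qed.

Definition leafgraph : graph X :=
  @Graph X [set: X] leaf_adj leaf_adj_sym leaf_adj_irr (fun _ _ _ => Logic.I).

Definition is_rball (D r : nat) (a : Gr R D) :=
  forall x, vert (repr a) x -> dist_le (repr a) r (root (repr a)) x.

(* [[H, o] = a] *)
Definition has_class (D : nat) (T : Type) (H : graph T) (o : T) (a : Gr R D) :=
  rooted_iso H (repr a) o (root (repr a)).

Definition cylinder (D r : nat) (a : Gr R D) : set (Gr R D) :=
  [set g : Gr R D |
    has_class (gball (repr g) (root (repr g)) r) (root (repr g)) a].

Definition is_law (D : nat) (P : probability (Gr_borel R D) R) :=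
  forall r (a : Gr R D), is_rball r a ->
    P (cylinder r a) = gmeas G [set x | has_class (gball leafgraph x r) x a].

End laws.

(* Main.v *)
From Pilot Require (* [root], [rgraph] and [induced] below are the notions of graphs. *)
Import Defs.
From HB Require Import structures.
From mathcomp Require Import all_boot all_order all_algebra.
From mathcomp Require Import all_classical all_reals all_analysis.
From mathcomp Require Import measurable_realfun.
(* [root], [rgraph] and [induced] below are the notions of graphs. *)
Import Defs.

Import Order.TTheory GRing.Theory Num.Theory.
Import numFieldNormedType.Exports.
Local Open Scope classical_set_scope.
Local Open Scope ring_scope.

Set Implicit Arguments.
Unset Strict Implicit.
Unset Printing Implicit Defensive.

(** Send a point [x] of the graphing to the class of its rooted component in the
    leafgraph. The law is the push-forward of the measure under this map, and
    unimodularity is mass transport along the involutions.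

    Measurability. Everything within distance [n] of [x] is reached by words of
    length at most [n] in the involutions, and the ball of radius [n] around
    [x] is known, up to isomorphism, once it is known which words of length at
    most [n.+1] lead from [x] to the same point ([word_pattern_iso]). These are
    finitely many conditions, each of them measurable because the diagonal of a
    standard Borel space is ([measurable_coincidence]). On the side of [Gr] and
    [vGr], an open set is a countable union of sets that depend only on a ball
    of fixed radius, so such sets generate the Borel sets ([borel_determined]).

    Uniqueness. The balls of radius [r] in the leafgraph have finitely many
    isomorphism types, so finitely many disjoint cylinders carry the whole mass
    of a law. Hence two laws agree on all sets that depend only on a ball of
    radius [r], and these form a generating family closed under intersection
    ([law_unique]).

    Unimodularity. The function to be integrated over [Gr] is a sum over the
    neighbours of the root. It is measurable: for the indicator function of a
    set that depends on a ball of radius [s], the sum depends on a ball of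
    radius [s.+1]; Dynkin's lemma and approximation by simple functions do the
    rest ([measurable_sum_list], [measurable_nbr_sum]). Pulled back to the
    graphing, it becomes the sum over the neighbours of [x] in the leafgraph.
    Attributing each edge to the first involution that produces it splits this
    sum into one term for each involution. An edge is attributed to the same
    involution from both of its endpoints, so the involution turns the term for
    outgoing edges into the term for incoming edges, and since it preserves the
    measure, the two integrals are equal ([graphing_law_unimodular]). *)

(** * Components and local isomorphisms *)

Section local_isomorphisms.
Variables (T T' : Type).
Implicit Types (G : graph T) (H : graph T').

Definition component G (o : T) : graph T :=
  induced G [set y | exists n, dist_le G n o y].

Lemma dist_le_trans G m n x y z :
  dist_le G m x y -> dist_le G n y z -> dist_le G (m + n) x z.
Proof.
move=> [p [xp <- pm]] [q [yq <- qn]]; exists (p ++ q).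
by rewrite cat_path last_cat size_cat leq_add// xp.
Qed.

Lemma dist_le_adj G x y : adj G x y -> dist_le G 1 x y.
Proof. by move=> xy; exists [:: y]; rewrite /= xy. Qed.

Lemma dist_le_sym G n x y : dist_le G n x y -> dist_le G n y x.
Proof.
elim: n y => [y [[|? ?] [_ //= <- _]]|n IH y]; first exact: dist_le0.
move=> Hd; case: (dist_leSP Hd) => [/IH|[z /IH zx zy]].
  exact: dist_le_widen.
rewrite -add1n; apply: dist_le_trans zx.
by apply: dist_le_adj; rewrite adj_sym.
Qed.

Lemma dist_le_vert G n x y : vert G x -> dist_le G n x y -> vert G y.
Proof.
move=> Gx; elim: n y => [y [[|? ?] [_ //= <- _]]//|n IH y].
move=> Hd; case: (dist_leSP Hd) => [/IH//|[z _]].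
by rewrite adj_sym; exact: adj_vert.
Qed.

Lemma dist_le_induced G (A : set T) n x y :
  (forall m z, (m <= n)%N -> dist_le G m x z -> A z) ->
  dist_le G n x y -> dist_le (induced G A) n x y.
Proof.
elim: n y => [y _ [[|? ?] [_ //= <- _]]|n IH y An]; first exact: dist_le0.
have An' m z : (m <= n)%N -> dist_le G m x z -> A z.
  by move=> mn; apply: An; exact: leqW.
move=> xy; have Ay : A y by exact: An xy.
case: (dist_leSP xy) => [{}xy|[z xz zy]].
  by apply: dist_le_widen (leqnSn n) _; exact: IH.
apply: dist_leS (IH _ An' xz) _.
by rewrite /= /induced_adj zy !mem_set//; exact: An' xz.
Qed.

Lemma induced_adjE G (A : set T) x y : A x -> A y ->
  adj (induced G A) x y = adj G x y.
Proof. by move=> Ax Ay; rewrite /= /induced_adj !mem_set// !andbT. Qed.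

Lemma vert_component_root G o : vert G o -> vert (component G o) o.
Proof. by move=> Go; split=> //; exists 0%N; exact: dist_le0. Qed.

Lemma component_eq G x y n : dist_le G n x y -> component G x = component G y.
Proof.
move=> xy; congr induced; apply/seteqP; split=> z [m xz].
  by exists (n + m)%N; apply: dist_le_trans xz; exact: dist_le_sym.
by exists (n + m)%N; exact: dist_le_trans xz.
Qed.

Lemma dist_le_homo G H (f : T -> T') n x y :
  (forall m u v, (m < n)%N -> dist_le G m x u -> adj G u v ->
    adj H (f u) (f v)) ->
  dist_le G n x y -> dist_le H n (f x) (f y).
Proof.
elim: n y => [y _ [[|? ?] [_ //= <- _]]|n IH y fadj]; first exact: dist_le0.
have fadj' m u v : (m < n)%N -> dist_le G m x u -> adj G u v ->
    adj H (f u) (f v) by move=> mn; apply: fadj; exact: ltnW.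
move=> Hd; case: (dist_leSP Hd) => [xy|[z xz zy]].
  by apply: dist_le_widen (leqnSn n) _; exact: IH.
by apply: dist_leS (IH _ fadj' xz) _; exact: fadj xz zy.
Qed.

End local_isomorphisms.

Section iso_local.

Lemma induced_iso_dist (T T' : Type) (G : graph T) (H : graph T')
    (A : set T) (B : set T') f x s :
  graph_iso (induced G A) (induced H B) f -> vert G x ->
  (forall z, dist_le G s x z -> A z) ->
  forall z, vert (gball G x s) z -> vert (gball H (f x) s) (f z).
Proof.
move=> [[fGH finj fsurj] fadj] Gx As z [Gz xz].
split; first by have [] := fGH z (conj Gz (As _ xz)).
apply: dist_le_homo xz => m u v ms xu uv.
have Gu : vert G u := dist_le_vert Gx xu.
have Gv : vert G v by move: uv; rewrite adj_sym; exact: adj_vert.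
have Au : A u by apply: As; apply: dist_le_widen xu; exact: ltnW.
have Av : A v by apply: As; apply: dist_le_widen (dist_leS xu uv).
have [_ Bu] := fGH u (conj Gu Au); have [_ Bv] := fGH v (conj Gv Av).
by rewrite -(induced_adjE _ Bu Bv) fadj// induced_adjE.
Qed.

(** A ball that fits inside the domain of a partial isomorphism, and whose image
    fits inside the target, is preserved: its paths never leave the domain. The
    domain may be a component or a ball around another center. *)
Lemma iso_local (T T' : Type) (G : graph T) (H : graph T')
    (A : set T) (B : set T') f x s :
  graph_iso (induced G A) (induced H B) f -> vert G x ->
  (forall z, dist_le G s x z -> A z) ->
  (forall z, dist_le H s (f x) z -> B z) ->
  graph_iso (gball G x s) (gball H (f x) s) f.
Proof.
move=> isof Gx As Bs; have [[fGH finj fsurj] fadj] := isof.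
have [g isog gf] := graph_iso_inv x isof.
have sub z : vert (gball G x s) z -> vert (induced G A) z.
  by move=> [Gz xz]; split=> //; exact: As.
have xs : vert (gball G x s) x by exact: gball_vert_root.
have Hfx : vert H (f x) by have [] := fGH x (sub x xs).
have fball := induced_iso_dist isof Gx As.
have gball' := induced_iso_dist isog Hfx Bs.
split; [split|].
- exact: fball.
- by move=> y z /set_mem /sub ys /set_mem /sub zs; apply: finj; rewrite inE.
- move=> y ys; exists (g y).
    by rewrite -{1}(gf x (sub x xs)); exact: gball'.
  have Hy : vert (induced H B) y by case: ys => Hy fxy; split=> //; exact: Bs.
  by have [z Az <-] := fsurj _ Hy; rewrite gf.
- move=> y z ys zs; rewrite !gball_adj//; try exact: fball.
  have [[Gy Ay] [Gz Az]] := (sub _ ys, sub _ zs).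
  have [_ By] := fGH y (conj Gy Ay); have [_ Bz] := fGH z (conj Gz Az).
  by rewrite -(induced_adjE _ By Bz) fadj// induced_adjE.
Qed.

Lemma component_iso_ball (T T' : Type) (G : graph T) (H : graph T') f x s :
  vert G x -> graph_iso (component G x) (component H (f x)) f ->
  graph_iso (gball G x s) (gball H (f x) s) f.
Proof. by move=> Gx isof; apply: (iso_local isof) => // z; exists s. Qed.

Lemma ball_iso_center (T T' : Type) (G : graph T) (H : graph T') f o x t s :
  graph_iso (gball G o (t + s)) (gball H (f o) (t + s)) f -> vert G o ->
  dist_le G t o x -> graph_iso (gball G x s) (gball H (f x) s) f.
Proof.
move=> isof Go ox; have Gx := dist_le_vert Go ox.
have ots := leq_addr s t.
have [_ fox] : vert (gball H (f o) t) (f x).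
  by apply: (gball_iso_dist Go ots isof erefl); split.
by apply: (iso_local isof) => // z; exact: dist_le_trans.
Qed.

Lemma component_connected (T : Type) (K : graph T) o :
  connected_graph K -> vert K o -> graph_iso (component K o) K id.
Proof.
move=> Kc Ko; have sub x : vert K x -> exists n, dist_le K n o x.
  by move=> Kx; exact: Kc.
split; first split.
- by move=> x [].
- by move=> x y.
- by move=> x Kx; exists x => //; split=> //; exact: sub.
- by move=> x y [Kx ox] [Ky oy]; rewrite induced_adjE.
Qed.

End iso_local.

(** * Isomorphism classes of rooted and birooted components *)

Section relabelling.
Variables (T : Type) (G : graph T) (D : nat).

(** The degree bound makes the balls of each radius finite, so a component is
    countable even when the vertex set of the graph is not. *)
Lemma countable_component o : max_degree_le G D -> vert G o ->
  countable (vert (component G o)).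
Proof.
move=> GD Go.
have ball n : countable [set y | dist_le G n o y].
  elim: n => [|n IH].
    apply: (@sub_countable _ _ _ [set o]); last exact: countable1.
    by apply: subset_card_le => y [[|? ?] [_ //= <- _]].
  apply: (@sub_countable _ _ _
      (\bigcup_(x in [set x | dist_le G n o x]) (x |` nbrs G x))).
    apply: subset_card_le => y oy; case: (dist_leSP oy) => [{}oy|[x ox xy]].
      by exists y => //; left.
    by exists x => //; right.
  apply: bigcup_countable => // x ox; apply: finite_set_countable.
  rewrite finite_setU; split=> //; apply: card_le_finite (GD x _) _ => //.
  exact: dist_le_vert ox.
apply: (@sub_countable _ _ _ (\bigcup_n [set y | dist_le G n o y])).
  by apply: subset_card_le => y [_ [n oy]]; exists n.
exact: bigcup_countable.
Qed.

Lemma induced_degree (A : set T) :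
  max_degree_le G D -> max_degree_le (induced G A) D.
Proof.
move=> GD x [Gx _]; apply: card_le_trans (GD x Gx).
by apply: subset_card_le => y /and3P[].
Qed.


Lemma connected_from (o : T) :
  (forall x, vert G x -> exists n, dist_le G n o x) -> connected_graph G.
Proof.
move=> Go x y /Go[m ox] /Go[n oy]; exists (m + n)%N.
by apply: dist_le_trans oy; exact: dist_le_sym.
Qed.

Definition relabel_adj (f : T -> nat) : rel nat := fun m n =>
  `[< m <> n /\ exists x y, [/\ adj G x y, f x = m & f y = n] >].

Lemma relabel_adj_sym f : symmetric (relabel_adj f).
Proof.
by move=> m n; apply: asbool_equiv_eq; split=> -[mn [x [y [xy fx fy]]]];
  (split; [exact: nesym|exists y, x; rewrite adj_sym]).
Qed.

Lemma relabel_adj_irr f : irreflexive (relabel_adj f).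
Proof. by move=> m; apply/asboolP => -[]. Qed.

Lemma relabel_adj_vert f m n : relabel_adj f m n -> (f @` vert G) m.
Proof.
by move=> /asboolP[_ [x [y [xy <- _]]]]; exists x => //; exact: adj_vert xy.
Qed.

Definition relabel (f : T -> nat) : graph nat :=
  Graph (relabel_adj_sym f) (@relabel_adj_irr f) (@relabel_adj_vert f).

Lemma relabel_iso f : {in vert G &, injective f} -> graph_iso G (relabel f) f.
Proof.
move=> finj; split; first by split=> // x Gx; exists x.
move=> x y Gx Gy; apply/asboolP/idP => [[_ [u [v [uv fu fv]]]]|xy].
  have Gu := adj_vert uv.
  have Gv : vert G v by move: uv; rewrite adj_sym; exact: adj_vert.
  by rewrite -(finj _ _ _ _ fu) ?inE// -(finj _ _ _ _ fv) ?inE.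
split; last by exists x, y.
move=> fxy; move: xy; rewrite (finj x y) ?inE//.
by rewrite adj_irr.
Qed.

End relabelling.

Lemma iso_connected (T T' : Type) (G : graph T) (H : graph T') f :
  graph_iso G H f -> connected_graph G -> connected_graph H.
Proof.
move=> [[_ _ fsurj] fadj] Gc _ _ /fsurj[x Gx <-] /fsurj[y Gy <-].
have [n xy] := Gc x y Gx Gy; exists n.
apply: dist_le_homo xy => m u v _ _ uv.
rewrite fadj//; first exact: adj_vert uv.
by move: uv; rewrite adj_sym; exact: adj_vert.
Qed.

Lemma iso_degree (T T' : Type) (G : graph T) (H : graph T') f D :
  graph_iso G H f -> max_degree_le G D -> max_degree_le H D.
Proof.
move=> [[fGH _ fsurj] fadj] GD _ /fsurj[x Gx <-].
apply: card_le_trans (GD x Gx); apply: card_le_trans (card_image_le f _).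
apply: subset_card_le => y xy.
have /fsurj[z Gz zy] : vert H y.
  by move: xy; rewrite /nbrs/= adj_sym; exact: adj_vert.
by exists z => //; rewrite /nbrs/= -fadj// zy.
Qed.

(** This is what gives a component of a graph of arbitrary size a class in [Gr]
    and in [vGr], whose points are represented on the natural numbers. *)
Lemma component_model (T : Type) (G : graph T) D o :
  max_degree_le G D -> vert G o ->
  exists (K : cgraph D) f, graph_iso (component G o) K f.
Proof.
move=> GD Go; have /countable_injP[f finj] := countable_component GD Go.
have isof := relabel_iso finj.
have Kc : connected_graph (relabel (component G o) f).
  apply: iso_connected isof _; apply: (connected_from (o := o)) => x [_ [n ox]].
  by exists n; apply: dist_le_induced => // m z _ oz; exists m.
have KD := iso_degree isof (@induced_degree _ _ _ _ GD).
by exists (CGraph Kc KD), f.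
Qed.

Section classes.
Variables (R : realType) (D : nat).

Lemma Gr_eq (a b : Gr R D) :
  rooted_iso (repr a) (repr b) (root (repr a)) (root (repr b)) -> a = b.
Proof.
by move=> ab; rewrite -[a]reprK -[b]reprK; apply/eqmodP/asboolP.
Qed.

Lemma repr_Gr (K : rgraph D) :
  rooted_iso K (repr (\pi_(Gr R D) K)%qT) (root K)
    (root (repr (\pi_(Gr R D) K)%qT)).
Proof.
have /eqmodP/asboolP// : (K = repr (\pi_(Gr R D) K) %[mod Gr R D])%qT.
by rewrite reprK.
Qed.

Variable D0 : (0 < D)%N.

Lemma vGr_eq (a b : vGr R D0) :
  birooted_iso (repr a) (repr b) (root1 (repr a)) (root2 (repr a))
    (root1 (repr b)) (root2 (repr b)) -> a = b.
Proof.
by move=> ab; rewrite -[a]reprK -[b]reprK; apply/eqmodP/asboolP.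
Qed.

Lemma repr_vGr (K : brgraph D) :
  birooted_iso K (repr (\pi_(vGr R D0) K)%qT) (root1 K) (root2 K)
    (root1 (repr (\pi_(vGr R D0) K)%qT)) (root2 (repr (\pi_(vGr R D0) K)%qT)).
Proof.
have /eqmodP/asboolP// : (K = repr (\pi_(vGr R D0) K) %[mod vGr R D0])%qT.
by rewrite reprK.
Qed.

(** The classes [[G, o]] and [[G, o1, o2]], where [G] stands for the component
    of the root. Choosing them by their property keeps the models on the natural
    numbers out of sight and makes sense for graphs on any type. *)
Definition rclass (T : Type) (G : graph T) (o : T) : Gr R D :=
  get [set a : Gr R D | rooted_iso (component G o) (repr a) o (root (repr a))].

Definition vclass (T : Type) (G : graph T) (o1 o2 : T) : vGr R D0 :=
  get [set a : vGr R D0 | birooted_iso (component G o1) (repr a) o1 o2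
                 (root1 (repr a)) (root2 (repr a))].

Lemma rclassP (T : Type) (G : graph T) o : max_degree_le G D -> vert G o ->
  rooted_iso (component G o) (repr (rclass G o)) o (root (repr (rclass G o))).
Proof.
move=> GD Go; apply: (@getPex (Gr R D)
  [set a : Gr R D | rooted_iso (component G o) (repr a) o (root (repr a))]).
have [K [f isof]] := component_model GD Go.
have Kfo : vert K (f o).
  by have [[fGK _ _] _] := isof; exact/fGK/vert_component_root.
exists (\pi_(Gr R D) (RGraph Kfo))%qT.
by apply: rooted_iso_trans (repr_Gr _); exists f.
Qed.

Lemma vclassP (T : Type) (G : graph T) o1 o2 :
  max_degree_le G D -> adj G o1 o2 ->
  let a := vclass G o1 o2 in
  birooted_iso (component G o1) (repr a) o1 o2
    (root1 (repr a)) (root2 (repr a)).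
Proof.
move=> GD o12 /=; apply: (@getPex (vGr R D0)
  [set a : vGr R D0 | birooted_iso (component G o1) (repr a) o1 o2
             (root1 (repr a)) (root2 (repr a))]).
have Go1 := adj_vert o12.
have [K [f isof]] := component_model GD Go1.
have Kf12 : adj K (f o1) (f o2).
  have [_ ->] := isof; last 2 first.
  - exact: vert_component_root.
  - split; first by move: o12; rewrite adj_sym; exact: adj_vert.
    by exists 1%N; exact: dist_le_adj.
  rewrite induced_adjE//; first by exists 0%N; exact: dist_le0.
  by exists 1%N; exact: dist_le_adj.
exists (\pi_(vGr R D0) (BRGraph Kf12))%qT.
by apply: birooted_iso_trans (repr_vGr _); exists f.
Qed.

Lemma vclass_pi (K : brgraph D) :
  vclass K (root1 K) (root2 K) = (\pi_(vGr R D0) K)%qT.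
Proof.
have K1 := root1_vert K; have K2 := root2_vert K.
have Kc := @component_connected _ K _ (@cg_connected _ K) K1.
apply: vGr_eq; apply: birooted_iso_sym; [exact: root1_vert|exact: root2_vert|].
apply: birooted_iso_trans (vclassP (@cg_degree _ K) (roots_adj K)).
apply: birooted_iso_trans (birooted_iso_sym K1 K2 (repr_vGr K)) _.
apply: birooted_iso_sym; last by exists id.
- exact: vert_component_root.
- by split=> //; exists 1%N; apply: dist_le_adj; exact: roots_adj.
Qed.

Lemma vclass_iso (T T' : Type) (G : graph T) (H : graph T') f x y :
  max_degree_le G D -> max_degree_le H D -> adj G x y ->
  graph_iso (component G x) (component H (f x)) f ->
  vclass G x y = vclass H (f x) (f y).
Proof.
move=> GD HD xy isof; have Gx := adj_vert xy.
have xyc : vert (component G x) y.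
  split; first by move: xy; rewrite adj_sym; exact: adj_vert.
  by exists 1%N; exact: dist_le_adj.
have xxc := vert_component_root Gx.
have fxy : adj H (f x) (f y).
  have [[fGH _ _] fadj] := isof.
  have [[_ fx] [_ fy]] := (fGH _ xxc, fGH _ xyc).
  rewrite -(induced_adjE _ fx fy) fadj// induced_adjE//; first exact: xxc.2.
  exact: xyc.2.
apply: vGr_eq.
apply: birooted_iso_trans (vclassP HD fxy).
apply: (@birooted_iso_trans _ _ _ _ (component G x) _ _ _ x y).
  by apply: birooted_iso_sym (vclassP GD xy).
by exists f.
Qed.

End classes.

Section agreement.
Variables (R : realType) (D : nat).

Lemma rgraph_component (K : rgraph D) :
  rooted_iso K (component K (root K)) (root K) (root K).
Proof.
apply: rooted_iso_sym; first exact/vert_component_root/root_vert.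
exists id => //.
exact: component_connected (@cg_connected _ K) (root_vert K).
Qed.

Lemma brgraph_component (K : brgraph D) :
  birooted_iso K (component K (root1 K)) (root1 K) (root2 K)
    (root1 K) (root2 K).
Proof.
apply: birooted_iso_sym; first exact/vert_component_root/root1_vert.
  split; first exact: root2_vert.
  by exists 1%N; apply: dist_le_adj; exact: roots_adj.
exists id => //.
exact: component_connected (@cg_connected _ K) (root1_vert K).
Qed.

Lemma rclass_component (T : Type) (G : graph T) o :
  max_degree_le G D -> vert G o ->
  let K := repr (rclass R D G o) in
  rooted_iso (component G o) (component K (root K)) o (root K).
Proof.
by move=> GD Go; exact: rooted_iso_trans (rclassP R GD Go) (rgraph_component _).
Qed.

Lemma rclass_ball (T : Type) (G : graph T) o s :
  max_degree_le G D -> vert G o ->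
  let K := repr (rclass R D G o) in
  rooted_iso (gball G o s) (gball K (root K) s) o (root K).
Proof.
move=> GD Go /=; have [f isof fo] := rclass_component GD Go.
by exists f => //; rewrite -fo; apply: component_iso_ball => //; rewrite fo.
Qed.

Lemma rclass_agree (T T' : Type) (G : graph T) (H : graph T') o p s :
  max_degree_le G D -> max_degree_le H D -> vert G o -> vert H p ->
  rooted_iso (gball G o s) (gball H p s) o p ->
  Gr_agree (rclass R D G o) (rclass R D H p) s.
Proof.
move=> GD HD Go Hp op; apply: rooted_iso_trans (rclass_ball s HD Hp).
apply: rooted_iso_trans op; apply: rooted_iso_sym (rclass_ball s GD Go).
exact: gball_vert_root.
Qed.

Variable D0 : (0 < D)%N.

Lemma vclass_component (T : Type) (G : graph T) x y :
  max_degree_le G D -> adj G x y ->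
  let K := repr (vclass R D0 G x y) in
  birooted_iso (component G x) (component K (root1 K)) x y (root1 K) (root2 K).
Proof.
move=> GD xy /=.
exact: birooted_iso_trans (vclassP R D0 GD xy) (brgraph_component _).
Qed.

Lemma vclass_ball (T : Type) (G : graph T) x y s :
  max_degree_le G D -> adj G x y ->
  let K := repr (vclass R D0 G x y) in
  birooted_iso (gball G x s) (gball K (root1 K) s) x y (root1 K) (root2 K).
Proof.
move=> GD xy /=; have [f isof [fx fy]] := vclass_component GD xy.
exists f => //; rewrite -fx; apply: component_iso_ball => //.
  exact: adj_vert xy.
by rewrite fx.
Qed.

(** Agreement up to radius [0] holds by convention; from radius [1] on, the ball
    around the first root contains the second one. *)
Lemma vclass_agree (T T' : Type) (G : graph T) (H : graph T') f x y s :
  max_degree_le G D -> max_degree_le H D -> adj G x y -> adj H (f x) (f y) ->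
  graph_iso (gball G x s) (gball H (f x) s) f ->
  vGr_agree (vclass R D0 G x y) (vclass R D0 H (f x) (f y)) s.
Proof.
move=> GD HD xy fxy isof.
case: s => [|s] in isof *; [exact: vGr_agree0|right].
apply: birooted_iso_trans (vclass_ball s.+1 HD fxy).
apply: (@birooted_iso_trans _ _ _ _ (gball G x s.+1) _ _ _ x y).
  apply: birooted_iso_sym (vclass_ball s.+1 GD xy).
    by apply: gball_vert_root; exact: adj_vert xy.
  split; first by move: xy; rewrite adj_sym; exact: adj_vert.
  exact: dist_le_widen (dist_le_adj xy).
by exists f.
Qed.

(** One more unit of radius pays for moving the first root to a neighbour, so
    the same isomorphism serves for an edge in both orientations. *)
Lemma edge_agree (T T' : Type) (G : graph T) (H : graph T') f o x s :
  max_degree_le G D -> max_degree_le H D -> adj G o x ->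
  graph_iso (gball G o s.+1) (gball H (f o) s.+1) f ->
  [/\ adj H (f o) (f x),
      vGr_agree (vclass R D0 G o x) (vclass R D0 H (f o) (f x)) s &
      vGr_agree (vclass R D0 G x o) (vclass R D0 H (f x) (f o)) s].
Proof.
move=> GD HD ox isof; have Go := adj_vert ox.
have ox1 := dist_le_adj ox.
have oo : vert (gball G o s.+1) o by exact: gball_vert_root.
have xo : vert (gball G o s.+1) x.
  by split; [exact: dist_le_vert ox1|exact: dist_le_widen ox1].
have fox : adj H (f o) (f x).
  have [[fGH _ _] fadj] := isof.
  by rewrite -(gball_adj (fGH _ oo) (fGH _ xo)) fadj// gball_adj.
split=> //.
- apply: vclass_agree => //.
  exact: (gball_iso_restr Go (leqnSn s) isof erefl).
- apply: vclass_agree => //; rewrite 1?adj_sym//.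
  exact: (@ball_iso_center _ _ G H f o x 1 s isof Go ox1).
Qed.

End agreement.

Section determined_sets.
Variables (R : realType) (Q : pseudoPMetricType R) (agree : Q -> Q -> set nat).

Definition determined (s : nat) (A : set Q) :=
  forall x y, agree x y s -> A x -> A y.

Hypothesis ballE : forall (x : Q) (e : R), ball x e = agree_ball agree x e.
Hypothesis agree0 : forall x y, agree x y 0%N.
Hypothesis agree_le : forall x y s t, (t <= s)%N -> agree x y s -> agree x y t.
Hypothesis agree_trans : forall y x z s, agree x y s -> agree y z s ->
  agree x z s.
Hypothesis agree_refl : forall x s, agree x x s.

Lemma determined_open s A : determined s A -> open A.
Proof.
move=> sA; rewrite openE => x Ax; apply/nbhs_ballP.
have ln2 : 0 < ln 2 :> R by rewrite ln_gt0// ltr1n.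
(* [2 ^ - s], the radius whose open balls are the classes of agreement up to
   [s.+1] *)
exists (expR (- (s%:R * ln 2))) => /=; first exact: expR_gt0.
move=> y; rewrite ballE /agree_ball/=.
rewrite (agree_dist_lt agree0); last exact: expR_gt0.
rewrite expRK mulNr opprK mulfK ?gt_eqF//.
move=> [<-//|[t xyt]]; rewrite ltr_nat => st.
by apply: sA Ax; apply: agree_le xyt; exact: ltnW.
Qed.

(** Around each of its points an open set contains a ball, and balls are classes
    of agreement. The union of all classes of agreement up to [s] inside the
    open set is determined by [s], however many there are. *)
Lemma open_determined U : open U ->
  U = \bigcup_s [set x | forall y, agree x y s -> U y].
Proof.
move=> oU; apply/seteqP; split=> [x Ux|x [s _ sU]]; last exact: sU.
have /nbhs_ballP[e /= e0 xeU] : nbhs x U by exact: open_nbhs_nbhs.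
exists (Num.truncn (- (ln e / ln 2))).+1 => // y xy; apply: xeU.
rewrite ballE; apply/(agree_dist_lt agree0 _ _ e0); right.
by exists (Num.truncn (- (ln e / ln 2))).+1 => //; exact: Num.Theory.truncnS_gt.
Qed.

Lemma determined_core U s :
  determined s [set x | forall y, agree x y s -> U y].
Proof. by move=> x y xy xU z yz; apply: xU; exact: agree_trans yz. Qed.

Lemma determined_setI_closed : setI_closed [set A | exists s, determined s A].
Proof.
move=> A B [s sA] [t tB]; exists (maxn s t) => x y xy [Ax Bx]; split.
  by apply: sA Ax; apply: agree_le xy; exact: leq_maxl.
by apply: tB Bx; apply: agree_le xy; exact: leq_maxr.
Qed.

(** Sets determined by a radius are both open and closed under intersection, so
    they can replace the open sets in arguments about measures. *)
Lemma borel_determined :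
  <<s (@open Q) >> = <<s [set A | exists s, determined s A] >>.
Proof.
apply/seteqP; split; last first.
  apply: smallest_sub; first exact: smallest_sigma_algebra.
  move=> A [s sA]; apply: sub_sigma_algebra; exact: determined_open sA.
apply: smallest_sub; first exact: smallest_sigma_algebra.
move=> U /open_determined ->.
have := @bigcupT_measurable _
  (g_sigma_algebraType [set A | exists s, determined s A]).
apply=> s; apply: sub_sigma_algebra; exists s; exact: determined_core.
Qed.

End determined_sets.

Section Borel_generators.
Variables (R : realType) (D : nat).

Lemma Gr_agree_refl (g : Gr R D) s : Gr_agree g g s.
Proof. exact: rooted_iso_refl. Qed.

Lemma Gr_borel_determined :
  @measurable _ (Gr_borel R D) =
  <<s [set A | exists s, determined (@Gr_agree R D) s A] >>.
Proof.
apply: (@borel_determined R (Gr R D) (@Gr_agree R D)) => //.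
- exact: Gr_agree0.
- exact: Gr_agree_le.
- exact: Gr_agree_trans.
- exact: Gr_agree_refl.
Qed.

Lemma Gr_setI_closed :
  setI_closed [set A | exists s, determined (@Gr_agree R D) s A].
Proof. exact: determined_setI_closed (@Gr_agree_le R D). Qed.

Variable D0 : (0 < D)%N.

Lemma vGr_borel_determined :
  @measurable _ (vGr_borel R D0) =
  <<s [set A | exists s, determined (@vGr_agree R D D0) s A] >>.
Proof.
apply: (@borel_determined R (vGr R D0) (@vGr_agree R D D0)) => //.
- exact: vGr_agree0.
- exact: vGr_agree_le.
- exact: vGr_agree_trans.
- by move=> g s; right; exact: birooted_iso_refl.
Qed.

Lemma vGr_setI_closed :
  setI_closed [set A | exists s, determined (@vGr_agree R D D0) s A].
Proof. exact: determined_setI_closed (@vGr_agree_le R D D0). Qed.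

End Borel_generators.

(** * Measurability of finite sums along a list of points *)

(** A point [t] carries a finite list [L t] of points of another space, with
    repetitions, in an order that need not depend on [t] in a measurable way;
    here the lists are the classes of the edges at the root. What is measurable
    in [t] is the number of entries in a set, and hence every symmetric sum. *)
Section sums_along_lists.
Context d d' (T : measurableType d) (U : measurableType d') (R : realType).
Variable L : T -> seq U.
Variable B : set (set U).
Hypotheses (BE : @measurable _ U = <<s B >>) (BI : setI_closed B).
Hypothesis BT : B [set: U].
Hypothesis mB : forall A, B A ->
  measurable_fun [set: T] (fun t => \sum_(a <- L t) \1_A a : R).

Lemma cvg_sum_list (s : seq U) (u : nat -> U -> R) (l : U -> R) :
  (forall a, u n a @[n --> \oo] --> l a) ->
  \sum_(a <- s) u n a @[n --> \oo] --> \sum_(a <- s) l a.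
Proof.
move=> ul; elim: s => [|a s IH].
  by under eq_fun do rewrite big_nil; rewrite big_nil; exact: cvg_cst.
by under eq_fun do rewrite big_cons; rewrite big_cons; exact: cvgD.
Qed.

(** Dynkin's lemma: counts are subtracted for complements and added for disjoint
    unions. *)
Lemma measurable_count A : measurable A ->
  measurable_fun [set: T] (fun t => \sum_(a <- L t) \1_A a : R).
Proof.
rewrite BE; move: A; apply: (@dynkin_induction _ _ B (fun A =>
  measurable_fun [set: T] (fun t => \sum_(a <- L t) \1_A a : R)) BE BI).
- exact: mB.
- exact: mB.
- move=> A mA NA.
  rewrite (_ : (fun t => _) = (fun t => \sum_(a <- L t) \1_[set: U] a) \-
      (fun t => \sum_(a <- L t) \1_A a)); last first.
    apply/funext => t /=; rewrite -sumrB; apply: eq_bigr => a _.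
    rewrite !indicE in_setC in_setT.
    by case: (a \in A) => /=; rewrite ?subrr ?subr0.
  by apply: measurable_funB => //; exact: mB.
- move=> F mF tF NF.
  apply: (@measurable_fun_cvg _ _ _ _
      (fun n t => \sum_(a <- L t) \sum_(i < n) \1_(F i) a)).
    move=> n; under eq_fun do rewrite exchange_big/=.
    exact: measurable_sum.
  (* at each point [a], the partial sums of the indicator functions are
     constant from some index on *)
  move=> t _; apply: cvg_sum_list => a; rewrite indicE.
  have [/set_mem[k _ Fka]|/negP naF] := boolP (a \in \bigcup_n F n).
    apply: cvg_near_cst; near=> n.
    have kn : (k < n)%N by near: n; exact: nbhs_infty_gt.
    rewrite (bigD1 (Ordinal kn))//= indicE mem_set// big1 ?addr0// => i ik.
    rewrite indicE memNset// => Fia.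
    move/trivIsetP : tF => /(_ i k Logic.I Logic.I ik).
    by move=> /seteqP[+ _] => /(_ a); apply.
  rewrite (_ : (fun _ => _) = fun=> 0); first exact: cvg_cst.
  apply/funext => n; rewrite big1// => i _; rewrite indicE memNset// => Fia.
  by apply: naF; apply/mem_set; exists i.
Unshelve. all: by end_near. Qed.

Import HBNNSimple.

Lemma measurable_sum_list (f : U -> R) :
  measurable_fun [set: U] f -> (forall a, 0 <= f a) ->
  measurable_fun [set: T] (fun t => \sum_(a <- L t) f a).
Proof.
move=> mf f0; have mEf : measurable_fun [set: U] (EFin \o f).
  exact/measurable_EFinP.
pose g := nnsfun_approx measurableT mEf.
apply: (@measurable_fun_cvg _ _ _ _ (fun n t => \sum_(a <- L t) g n a)).
  move=> n; under eq_fun => t.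
    under eq_bigr => a _ do rewrite (fimfunEord (g n) a).
    rewrite exchange_big/=.
    under eq_bigr => i _ do rewrite -mulr_sumr.
    over.
  apply: measurable_sum => i; apply: measurable_funM => //.
  exact: measurable_count.
move=> t _; apply: cvg_sum_list => a.
have : (EFin \o g ^~ a @ \oo --> (f a)%:E)%E.
  by apply: cvg_nnsfun_approx => // x _; rewrite lee_fin.
by move=> /fine_cvg.
Qed.

End sums_along_lists.

(** * Sums over the neighbours of the root *)

Lemma nbrs_bij (T T' : Type) (G : graph T) (H : graph T') f o s :
  vert G o -> graph_iso (gball G o s.+1) (gball H (f o) s.+1) f ->
  set_bij (nbrs G o) (nbrs H (f o)) f.
Proof.
move=> Go isof; have [[fGH finj fsurj] fadj] := isof.
have oo : vert (gball G o s.+1) o by exact: gball_vert_root.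
have sub (T0 : Type) (K : graph T0) p x : adj K p x -> vert (gball K p s.+1) x.
  move=> px; split; first by move: px; rewrite adj_sym; exact: adj_vert.
  exact: dist_le_widen (dist_le_adj px).
split.
- move=> x ox; rewrite /nbrs/= -(gball_adj (fGH _ oo) (fGH _ (sub _ _ _ _ ox))).
  by rewrite fadj ?gball_adj//; exact: sub.
- by move=> x y /set_mem ox /set_mem oy; apply: finj; rewrite inE; exact: sub.
- move=> y oy; have [x xs fx] := fsurj _ (sub _ _ _ _ oy).
  exists x => //; rewrite /nbrs/= -(gball_adj oo xs) -fadj// fx gball_adj//.
    exact: fGH.
  exact: sub.
Qed.

Lemma finite_nbrs (T : Type) (G : graph T) D x :
  max_degree_le G D -> finite_set (nbrs G x).
Proof.
move=> GD; have [Gx|nGx] := pselect (vert G x).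
  exact: card_le_finite (GD x Gx) _.
rewrite (_ : nbrs G x = set0)//; apply/seteqP; split=> // y xy.
by apply: nGx; exact: adj_vert xy.
Qed.

Section neighbour_sums.
Variables (R : realType) (D : nat) (D0 : (0 < D)%N).

Let rg_degree (g : Gr R D) : max_degree_le (repr g) D := @cg_degree _ (repr g).

Lemma sum_out_class (f : vGr R D0 -> R) (K : rgraph D) :
  \sum_(x \in [set: nbrs K (root K)]) f (out_class R D0 x) =
  \sum_(n \in nbrs K (root K)) f (vclass R D0 K (root K) n).
Proof.
rewrite [RHS](reindex_fsbig (val : nbrs K (root K) -> nat) setT)/=; last first.
  split=> [x _|x y _ _|n rn]; first exact: set_valP.
    exact: val_inj.
  by exists (SigSub (mem_set rn)).
by apply: eq_fsbigr => x _; congr f; rewrite /out_class -vclass_pi.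
Qed.

Lemma sum_in_class (f : vGr R D0 -> R) (K : rgraph D) :
  \sum_(x \in [set: nbrs K (root K)]) f (in_class R D0 x) =
  \sum_(n \in nbrs K (root K)) f (vclass R D0 K n (root K)).
Proof.
rewrite [RHS](reindex_fsbig (val : nbrs K (root K) -> nat) setT)/=; last first.
  split=> [x _|x y _ _|n rn]; first exact: set_valP.
    exact: val_inj.
  by exists (SigSub (mem_set rn)).
by apply: eq_fsbigr => x _; congr f; rewrite /in_class -vclass_pi.
Qed.

Lemma determined_measurable_fun (F : Gr R D -> R) s :
  (forall g h, Gr_agree g h s -> F g = F h) ->
  measurable_fun [set: Gr_borel R D] F.
Proof.
move=> sF _ A _; rewrite setTI Gr_borel_determined; apply: sub_sigma_algebra.
by exists s => g h gh; rewrite /preimage/= (sF g h).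
Qed.

(** An isomorphism between balls of radius [s.+1] matches the edges at the roots,
    so the number of those with class in a set determined by [s] is constant on
    the classes of agreement up to [s.+1], and in particular measurable. *)
Lemma measurable_nbr_sum (c : Gr R D -> nat -> vGr R D0) :
  (forall s g h f, f (root (repr g)) = root (repr h) ->
    graph_iso (gball (repr g) (root (repr g)) s.+1)
              (gball (repr h) (root (repr h)) s.+1) f ->
    forall n, nbrs (repr g) (root (repr g)) n ->
      vGr_agree (c g n) (c h (f n)) s) ->
  forall f : vGr_borel R D0 -> R, measurable_fun setT f ->
  (forall a, 0 <= f a) ->
  measurable_fun [set: Gr_borel R D] (fun g : Gr R D =>
    \sum_(n \in nbrs (repr g) (root (repr g))) f (c g n)).
Proof.
move=> cloc f mf f0.
pose nl (g : Gr R D) := 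
  [seq c g n |
    n <- finmap.enum_fset (fset_set (nbrs (repr g) (root (repr g))))].
have nlE (F : vGr R D0 -> R) (g : Gr R D) :
    \sum_(n \in nbrs (repr g) (root (repr g))) F (c g n) =
    \sum_(a <- nl g) F a.
  by rewrite big_map fsbig_finite//; exact: finite_nbrs (@rg_degree g).
rewrite (_ : (fun g => _) = fun g : Gr_borel R D => \sum_(a <- nl g) f a);
  last first.
  by apply/funext => g; exact: nlE.
apply: (@measurable_sum_list _ _ (Gr_borel R D) (vGr_borel R D0) R nl _
  (vGr_borel_determined R D0)) => //.
- exact: vGr_setI_closed.
- by exists 0%N.
- move=> A [s sA].
  apply: (@determined_measurable_fun _ s.+1) => g h [e isoe e0].
  rewrite -!nlE.
  rewrite [RHS](reindex_fsbig e (nbrs (repr g) (root (repr g)))); last first.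
    by move: isoe; rewrite -e0; exact: nbrs_bij (root_vert _).
  apply: eq_fsbigr => n /set_mem rn; rewrite !indicE.
  have gh := cloc s g h e e0 isoe n rn.
  congr (nat_of_bool _)%:R; apply/idP/idP => /set_mem Aa; apply/mem_set.
    exact: sA Aa.
  by apply: sA Aa; exact: vGr_agree_sym.
Qed.

Lemma measurable_out_sum (f : vGr_borel R D0 -> R) :
  measurable_fun setT f -> (forall a, 0 <= f a) ->
  measurable_fun [set: Gr_borel R D] (fun g : Gr R D =>
    \sum_(x \in [set: nbrs (repr g) (root (repr g))]) f (out_class R D0 x)).
Proof.
move=> mf f0; under eq_fun do rewrite sum_out_class.
apply: (@measurable_nbr_sum (fun g n =>
  vclass R D0 (repr g) (root (repr g)) n)) => //.
move=> s g h e e0 isoe n rn; rewrite -e0 in isoe *.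
by have [] := edge_agree R D0 (@rg_degree g) (@rg_degree h) rn isoe.
Qed.

Lemma measurable_in_sum (f : vGr_borel R D0 -> R) :
  measurable_fun setT f -> (forall a, 0 <= f a) ->
  measurable_fun [set: Gr_borel R D] (fun g : Gr R D =>
    \sum_(x \in [set: nbrs (repr g) (root (repr g))]) f (in_class R D0 x)).
Proof.
move=> mf f0; under eq_fun do rewrite sum_in_class.
apply: (@measurable_nbr_sum (fun g n =>
  vclass R D0 (repr g) n (root (repr g)))) => //.
move=> s g h e e0 isoe n rn; rewrite -e0 in isoe *.
by have [] := edge_agree R D0 (@rg_degree g) (@rg_degree h) rn isoe.
Qed.

(** An isomorphism from a component onto the representative of its class carries
    neighbours of the root to neighbours of the root and preserves the classes
    of edges, in both orientations. *)
Lemma sum_out_rclass (T : choiceType) (G : graph T) o (f : vGr R D0 -> R) :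
  max_degree_le G D -> vert G o ->
  let K := repr (rclass R D G o) in
  \sum_(x \in [set: nbrs K (root K)]) f (out_class R D0 x) =
  \sum_(y \in nbrs G o) f (vclass R D0 G o y).
Proof.
move=> GD Go /=; rewrite sum_out_class.
have [e isoe e0] := rclass_component R GD Go; rewrite -e0 in isoe *.
rewrite (reindex_fsbig e (nbrs G o)); last first.
  exact: nbrs_bij Go (component_iso_ball 1 Go isoe).
by apply: eq_fsbigr => y /set_mem oy; rewrite -(vclass_iso _ _ GD _ oy isoe).
Qed.

Lemma sum_in_rclass (T : choiceType) (G : graph T) o (f : vGr R D0 -> R) :
  max_degree_le G D -> vert G o ->
  let K := repr (rclass R D G o) in
  \sum_(x \in [set: nbrs K (root K)]) f (in_class R D0 x) =
  \sum_(y \in nbrs G o) f (vclass R D0 G y o).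
Proof.
move=> GD Go /=; rewrite sum_in_class.
have [e isoe e0] := rclass_component R GD Go; rewrite -e0 in isoe *.
have ebij := nbrs_bij Go (component_iso_ball 1 Go isoe).
rewrite (reindex_fsbig e (nbrs G o)); last exact: ebij.
apply: eq_fsbigr => y /set_mem oy; congr f.
have [/(_ _ oy) eoy _ _] := ebij.
rewrite -(@vclass_iso _ _ _ _ _ G _ e y o GD)//; first by rewrite adj_sym.
by rewrite -(component_eq (dist_le_adj oy)) -(component_eq (dist_le_adj eoy)).
Qed.

End neighbour_sums.

(** * Finitely many measurable tests *)

Section finitely_many_tests.
Variables (T : choiceType) (I : eqType) (A : I -> set T).

(** Each test splits the set in two, so induction on the list of tests yields
    a finite list of representatives. *)
Lemma finite_test_classes (s : seq I) (S : set T) :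
  exists2 xs : seq T, (forall x, x \in xs -> S x) &
    forall y, S y -> exists2 x, x \in xs & forall i, i \in s -> A i x <-> A i y.
Proof.
elim: s S => [|i s IH] S.
  have [[x Sx]|S0] := pselect (exists x, S x).
    exists [:: x] => [z|y _]; first by rewrite inE => /eqP ->.
    by exists x; rewrite ?inE.
  by exists [::] => // y Sy; case: S0; exists y.
have [xs xsS xsP] := IH (S `&` A i); have [ys ysS ysP] := IH (S `\` A i).
exists (xs ++ ys) => [x|y Sy].
  by rewrite mem_cat => /orP[/xsS[]|/ysS[]].
have [Ay|nAy] := pselect (A i y).
  have [x xxs xy] := xsP y (conj Sy Ay); exists x; first by rewrite mem_cat xxs.
  move=> j; rewrite inE => /predU1P[->|/xy//].
  by split=> // _; have [] := xsS _ xxs.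
have [x xys xy] := ysP y (conj Sy nAy); exists x.
  by rewrite mem_cat xys orbT.
move=> j; rewrite inE => /predU1P[->|/xy//].
by split=> // Ax; have [] := ysS _ xys.
Qed.

End finitely_many_tests.

Lemma measurable_tested d (T : measurableType d) (I : choiceType)
    (A : I -> set T) (s : seq I) (S : set T) :
  (forall i, measurable (A i)) ->
  (forall x y, (forall i, i \in s -> A i x <-> A i y) -> S x -> S y) ->
  measurable S.
Proof.
move=> mA AS; have [xs xsS xsP] := finite_test_classes A s S.
rewrite (_ : S = \bigcup_(x in [set` xs]) \bigcap_(i in [set` s])
    [set y | A i x <-> A i y]); last first.
  apply/seteqP; split=> [y /xsP[x xxs xy]|y [x /= xxs xy]].
    by exists x => // i /= /xy.
  by apply: AS (xsS _ xxs).
apply: fin_bigcup_measurable => // x _; apply: fin_bigcap_measurable => // i _.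
have [Ax|nAx] := pselect (A i x).
  rewrite (_ : [set y | _] = A i)//.
  by apply/seteqP; split=> y /=; tauto.
rewrite (_ : [set y | _] = ~` A i); first exact: measurableC.
by apply/seteqP; split=> y /=; tauto.
Qed.

(** In a separable Hausdorff pseudometric space, two distinct points are
    separated by one of countably many open sets, the interiors of the balls
    with center in a countable dense set and radius [1 / (p + 1)]. *)
Lemma standard_borel_separated (R : realType) d (X : measurableType d) :
  standard_borel R X ->
  exists2 B : nat -> set X, (forall n, measurable (B n)) &
    forall x y, x <> y -> exists n, B n x /\ ~ B n y.
Proof.
move=> [Y [hY [S /countable_injP[f finj] dS] [phi bphi phiP]]].
pose r (p : nat) : R := p.+1%:R^-1.
pose U m p : set Y := \bigcup_(s in S `&` f @^-1` [set m]) (ball s (r p))°.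
have mU m p : measurable (phi @^-1` U m p).
  apply/phiP; apply: sub_sigma_algebra.
  by apply: bigcup_open => s _; exact: open_interior.
exists (fun n => if unpickle n is Some mp then phi @^-1` U mp.1 mp.2 else set0).
  by move=> n; case: unpickle => [[m p]|]; [exact: mU|exact: measurable0].
move=> x y xy; have /eqP pxy : phi x <> phi y by move=> /(bij_inj bphi).
move: hY; rewrite ball_hausdorff => /(_ _ _ pxy)[[e e'] /= /eqP ee'].
have nxy : ~ ball (phi x) e%:num (phi y).
  move=> pxe; suff : (set0 : set Y) (phi y) by [].
  by rewrite -ee'; split=> //; exact: ballxx.
pose p := Num.truncn (2 / e%:num).
have rp0 : 0 < r p by rewrite invr_gt0 ltr0Sn.
have rpe : r p + r p <= e%:num.
  have : 2 / e%:num < p.+1%:R by exact: truncnS_gt.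
  rewrite ltr_pdivrMr// mulrC -ltr_pdivrMr ?ltr0Sn// => /ltW.
  by rewrite -[2]/(1 + 1) mulrDl !mul1r.
have [s [/interior_subset xs Ss]] : (ball (phi x) (r p / 2))° `&` S !=set0.
  apply: dS; last exact: open_interior.
  by exists (phi x); apply: nbhsx_ballx; exact: divr_gt0.
exists (pickle (f s, p)); rewrite pickleK /=; split.
  exists s => //; apply: filterS (nbhsx_ballx (phi x) (r p / 2) _).
    by move=> z xz; exact: ball_splitr xs xz.
  exact: divr_gt0.
(* distinct centers have distinct indices, so [s] is the only center here *)
move=> [s' [Ss' fs'] /interior_subset s'y]; apply: nxy.
have {}fs' : s' = s by apply: finj; rewrite ?inE.
move: s'y; rewrite fs' => sy; apply: le_ball rpe _ _.
apply: (ball_triangle _ sy).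
by apply: le_ball xs; rewrite ler_pdivrMr// ler_peMr ?ler1n// ltW.
Qed.

(** The diagonal is the complement of a countable union of rectangles
    [B n * ~` B n]. *)
Lemma measurable_coincidence (R : realType) d d' (X : measurableType d)
    (Z : measurableType d') (a b : Z -> X) :
  standard_borel R X -> measurable_fun setT a -> measurable_fun setT b ->
  measurable [set z | a z = b z].
Proof.
move=> /standard_borel_separated[B mB Bsep] ma mb.
rewrite (_ : [set z | _] =
  ~` \bigcup_n ((a @^-1` B n) `&` ~` (b @^-1` B n))); last first.
  apply/seteqP; split=> [z /= abz [n _ []] /=|z /= nabz]; first by rewrite abz.
  apply: contrapT => /Bsep[n [an bn]]; apply: nabz; exists n => //.
apply: measurableC; apply: bigcupT_measurable => n; apply: measurableI.
  by rewrite -[X in measurable X]setTI; exact: ma.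
by apply: measurableC; rewrite -[X in measurable X]setTI; exact: mb.
Qed.

(** * Words of involutions *)

Section words.
Variables (R : realType) (d : measure_display) (X : measurableType d).
Variables (k : nat) (G : graphing R X k).

Local Notation L := (leafgraph G).

Definition act (w : seq 'I_k) (x : X) : X := foldr (invol G) x w.

Lemma measurable_act w : measurable_fun [set: X] (act w).
Proof.
elim: w => [|j w IH] /=; first exact: measurable_id.
exact: measurableT_comp (@invol_measurable _ _ _ _ G j) IH.
Qed.

(** Letters that fix the current point do not lengthen the path in the
    leafgraph, so words of length at most [n] reach exactly the ball. *)
Lemma leaf_distP n x y :
  dist_le L n x y <-> exists2 w, (size w <= n)%N & act w x = y.
Proof.
split.
  elim: n y => [y [[|? ?] [_ //= <- _]]|n IH y xy]; first by exists [::].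
  case: (dist_leSP xy) => [/IH[w wn <-]|[z /IH[w wn <-]]].
    by exists w => //; exact: leqW.
  by move=> /asboolP[_ [j ->]]; exists (j :: w).
move=> [w + <-] {y}; elim: w n => [|j w IH] n /=.
  by move=> _; exact: dist_le_widen (dist_le0 _ _).
case: n => // n /IH wn.
have [jw|/eqP jw] := eqVneq (invol G j (act w x)) (act w x).
  by rewrite jw; exact: dist_le_widen wn.
apply: dist_leS wn _; apply/asboolP; split; last by exists j.
exact: nesym.
Qed.

Fixpoint words (n : nat) : seq (seq 'I_k) :=
  if n is n'.+1 then
    [::] :: [seq j :: w | j <- enum 'I_k, w <- words n']
  else [:: [::]].

Lemma mem_words n w : (w \in words n) = (size w <= n)%N.
Proof.
elim: n w => [|n IH] [|j w] //=.
rewrite inE /= ltnS -IH; apply/allpairsP/idP => [[[i v] /= [_ vn [_ ->]]]//|wn].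
by exists (j, w); rewrite /= mem_enum.
Qed.

(** The coincidences between the points reached by short words are finitely
    many measurable tests; they decide the isomorphism type of the ball. *)
Definition same_word_pattern n x y := forall u v, (size u <= n)%N ->
  (size v <= n)%N -> act u x = act v x <-> act u y = act v y.

Lemma measurable_word_pattern n (S : set X) :
  (forall x y, same_word_pattern n x y -> S x -> S y) -> measurable S.
Proof.
move=> nS; pose A (p : seq 'I_k * seq 'I_k) := [set x | act p.1 x = act p.2 x].
apply: (@measurable_tested _ _ _ A [seq (u, v) | u <- words n, v <- words n]).
  move=> p; apply: measurable_coincidence (graphing_borel G) _ _;
    exact: measurable_act.
move=> x y xy; apply: nS => u v un vn; apply: (xy (u, v)).
by apply/allpairsP; exists (u, v); rewrite /= !mem_words.
Qed.

Lemma finite_word_patterns n : exists xs : seq X,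
  forall y, exists2 x, x \in xs & same_word_pattern n x y.
Proof.
pose A (p : seq 'I_k * seq 'I_k) := [set x | act p.1 x = act p.2 x].
have [xs _ xsP] := finite_test_classes A
  [seq (u, v) | u <- words n, v <- words n] setT.
exists xs => y; have [//|x xxs xy] := xsP y; exists x => // u v un vn.
apply: (xy (u, v)); apply/allpairsP.
by exists (u, v); rewrite /= !mem_words.
Qed.

(** Matching endpoints of words is well defined and injective by the pattern up
    to length [n]; whether an involution joins two of them is read off from one
    more letter. *)
Lemma word_pattern_iso n x y : same_word_pattern n.+1 x y ->
  exists2 f, graph_iso (gball L x n) (gball L y n) f &
    forall w, (size w <= n)%N -> f (act w x) = act w y.
Proof.
move=> xy.
have /choice[c cP] : forall z, exists w, dist_le L n x z ->
    (size w <= n)%N /\ act w x = z.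
  move=> z; have [/leaf_distP[w wn <-]|nz] := pselect (dist_le L n x z).
    by exists w.
  by exists [::].
have fE w : (size w <= n)%N -> act (c (act w x)) y = act w y.
  move=> wn; have [|cn cw] := cP (act w x); first by apply/leaf_distP; exists w.
  by apply/xy => //; exact: leqW.
exists (fun z => act (c z) y) => //; split; first split.
- move=> z [_ /leaf_distP[w wn <-]]; rewrite fE//; split=> //.
  by apply/leaf_distP; exists w.
- move=> z z' /set_mem[_ /leaf_distP[w wn <-]] /set_mem[_ /leaf_distP[v vn <-]].
  by rewrite !fE// => wv; apply/xy => //; exact: leqW.
- move=> z [_ /leaf_distP[w wn <-]]; exists (act w x); last exact: fE.
  by split=> //; apply/leaf_distP; exists w.
- move=> z z' [_ /leaf_distP[w wn wz]] [_ /leaf_distP[v vn vz]].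
  have bx u : (size u <= n)%N -> vert (gball L x n) (act u x).
    by move=> un; split=> //; apply/leaf_distP; exists u.
  have by_ u : (size u <= n)%N -> vert (gball L y n) (act u y).
    by move=> un; split=> //; apply/leaf_distP; exists u.
  rewrite -wz -vz !fE// !gball_adj//;
    [|exact: bx|exact: bx|exact: by_|exact: by_].
  apply: asbool_equiv_eq; split=> -[wv [j jw]].
    split; first by move=> wvx; apply: wv; apply/xy => //; exact: leqW.
    by exists j; apply/(xy v (j :: w)) => //; exact: leqW.
  split; first by move=> wvx; apply: wv; apply/xy => //; exact: leqW.
  by exists j; apply/(xy v (j :: w)) => //; exact: leqW.
Qed.

End words.

(** * Uniqueness of the law *)

Lemma probability_setI1 d (T : measurableType d) (R : realType)
    (P : probability T R) (U A : set T) :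
  measurable U -> measurable A -> P U = 1%E -> P (U `&` A) = P A.
Proof.
move=> mU mA PU; rewrite [RHS](measureDI P mA mU) setIC.
rewrite [X in _ = (X + _)%E](_ : _ = 0%E) ?add0e//.
apply/eqP; rewrite eq_le measure_ge0 andbT.
have <- : P (~` U) = 0%E by rewrite probability_setC// PU subee.
apply: le_measure; rewrite ?inE; [exact: measurableD|exact: measurableC|].
by move=> g [].
Qed.

Section cylinders.
Variables (R : realType) (D : nat).

Lemma determined_cylinder r (a : Gr R D) :
  determined (@Gr_agree R D) r (cylinder r a).
Proof.
move=> g h gh ga; apply: rooted_iso_trans ga; apply: rooted_iso_sym gh.
exact/gball_vert_root/root_vert.
Qed.

Lemma determined_measurable r (A : set (Gr R D)) :
  determined (@Gr_agree R D) r A -> measurable (A : set (Gr_borel R D)).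
Proof.
by move=> rA; rewrite Gr_borel_determined; apply: sub_sigma_algebra; exists r.
Qed.

Lemma cylinder_agree r (a g h : Gr R D) :
  cylinder r a g -> cylinder r a h -> Gr_agree g h r.
Proof.
move=> ga ha; apply: rooted_iso_trans ga _; apply: rooted_iso_sym ha.
exact/gball_vert_root/root_vert.
Qed.

Lemma cylinder_inj r (a b g : Gr R D) :
  cylinder r a g -> cylinder r b g -> a = b.
Proof.
move=> ga gb; apply: Gr_eq; apply: rooted_iso_trans gb.
by apply: rooted_iso_sym ga; exact/gball_vert_root/root_vert.
Qed.

Definition cylinders r (s : seq (Gr R D)) : set (Gr R D) :=
  [set g | exists2 a, a \in s & cylinder r a g].

Lemma determined_cylinders r s : determined (@Gr_agree R D) r (cylinders r s).
Proof.
by move=> g h gh [a as_ ga]; exists a => //; exact: determined_cylinder gh ga.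
Qed.

(** A set determined by the radius of the cylinders contains each of them or
    misses it, so finitely many values on cylinders decide the measure of the
    part of the set that they cover. *)
Lemma measure_cylinders (P Q : probability (Gr_borel R D) R) r
    (s : seq (Gr R D)) :
  (forall a, a \in s -> P (cylinder r a) = Q (cylinder r a)) ->
  forall A, determined (@Gr_agree R D) r A ->
    P (cylinders r s `&` A) = Q (cylinders r s `&` A).
Proof.
move=> PQ A rA; have mA := determined_measurable rA.
have mC a := determined_measurable (@determined_cylinder r a).
have mU t := determined_measurable (@determined_cylinders r t).
have PQC a : a \in s -> P (cylinder r a `&` A) = Q (cylinder r a `&` A).
  move=> /PQ PQa; have [[g [ag Ag]]|nA] := pselect (cylinder r a `&` A !=set0).
    suff -> : cylinder r a `&` A = cylinder r a by [].
    apply/seteqP; split=> [h []//|h ah]; split=> //; apply: rA Ag.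
    exact: cylinder_agree ag ah.
  suff -> : cylinder r a `&` A = set0 by rewrite !measure0.
  by rewrite -subset0 => h hA; apply: nA; exists h.
suff: forall t, {subset t <= s} ->
  P (cylinders r t `&` A) = Q (cylinders r t `&` A) by apply.
elim=> [_|a t IH ts].
  suff -> : cylinders r [::] = set0 by rewrite set0I !measure0.
  by rewrite -subset0 => h [].
have {}IH : P (cylinders r t `&` A) = Q (cylinders r t `&` A).
  by apply: IH => b bt; apply: ts; rewrite inE bt orbT.
have [at_|nat_] := boolP (a \in t).
  suff -> : cylinders r (a :: t) = cylinders r t by [].
  apply/seteqP; split=> g [b bt gb]; exists b => //.
    by move: bt; rewrite inE => /predU1P[->|].
  by rewrite inE bt orbT.
have -> : cylinders r (a :: t) `&` A =
    (cylinder r a `&` A) `|` (cylinders r t `&` A).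
  rewrite -setIUl; congr (_ `&` _); apply/seteqP; split=> g.
    by move=> [b]; rewrite inE => /predU1P[->|bt] gb; [left|right; exists b].
  by move=> [ga|[b bt gb]]; [exists a|exists b]; rewrite // inE ?eqxx// bt orbT.
have disj : (cylinder r a `&` A) `&` (cylinders r t `&` A) = set0.
  rewrite -subset0 => g [[ga _] [[b bt gb] _]].
  by move: nat_; rewrite (cylinder_inj ga gb) bt.
have mI (B : set (Gr_borel R D)) : measurable B -> measurable (B `&` A).
  by move=> mB; exact: measurableI.
rewrite !measureU//; try exact: mI.
congr (_ + _)%E; last exact: IH.
by apply: PQC; rewrite ts// inE eqxx.
Qed.

End cylinders.

Section ball_classes.
Variables (R : realType) (D : nat) (T : Type) (G : graph T).
Hypothesis GD : max_degree_le G D.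

Lemma gball_connected o r : connected_graph (gball G o r).
Proof.
apply: (connected_from (o := o)) => x [_ ox]; exists r.
by apply: dist_le_induced => // m z mr oz; exact: dist_le_widen oz.
Qed.

Lemma rclass_gballP o r : vert G o ->
  has_class (gball G o r) o (rclass R D (gball G o r) o).
Proof.
move=> Go; have Bo := gball_vert_root r Go.
apply: rooted_iso_trans (rclassP R _ Bo); last exact: induced_degree.
apply: rooted_iso_sym; first exact: vert_component_root.
by exists id => //; apply: component_connected Bo; exact: gball_connected.
Qed.

Lemma rclass_gball_rball o r : vert G o ->
  is_rball r (rclass R D (gball G o r) o).
Proof.
move=> Go x ax; have [f [[_ _ fsurj] fadj] <-] := rclass_gballP r Go.
have [z [Gz oz] <-] := fsurj _ ax.
have {}oz : dist_le (gball G o r) r o z.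
  by apply: dist_le_induced oz => m y mr; exact: dist_le_widen.
apply: dist_le_homo oz => m u v _ _ uv.
rewrite fadj//; first exact: adj_vert uv.
by move: uv; rewrite adj_sym; exact: adj_vert.
Qed.

End ball_classes.

(** * The law of a graphing *)

Section law.
Variables (R : realType) (d : measure_display) (X : measurableType d).
Variables (k : nat) (G : graphing R X k) (D : nat).
Hypothesis LD : max_degree_le (leafgraph G) D.

Local Notation L := (leafgraph G).

Lemma leaf_class_agree n x y : same_word_pattern G n.+1 x y ->
  Gr_agree (rclass R D L x) (rclass R D L y) n.
Proof.
move=> /word_pattern_iso[f isof fact]; apply: rclass_agree => //.
by exists f => //; exact: (fact [::]).
Qed.

Lemma measurable_leaf_class :
  measurable_fun [set: X] (rclass R D L : X -> Gr_borel R D).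
Proof.
apply: (@measurability _ _ X (Gr_borel R D) setT (rclass R D L) _
  (Gr_borel_determined R D)) => _ [A [s sA] <-].
rewrite setTI; apply: (@measurable_word_pattern _ _ _ _ G s.+1) => x y xy.
by apply: sA; exact: leaf_class_agree.
Qed.

Lemma leaf_class_cylinder r (a : Gr R D) :
  rclass R D L @^-1` cylinder r a = [set x | has_class (gball L x r) x a].
Proof.
apply/seteqP; split=> x xa.
  exact: rooted_iso_trans (rclass_ball R r LD Logic.I) xa.
apply: rooted_iso_trans xa; apply: rooted_iso_sym (rclass_ball R r LD Logic.I).
exact: gball_vert_root.
Qed.

Definition leaf_class : {mfun X >-> Gr_borel R D} :=
  mfun_Sub (mem_set measurable_leaf_class).

Definition graphing_law : probability (Gr_borel R D) R :=
  distribution (gmeas G) leaf_class.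

Lemma graphing_lawE A : graphing_law A = gmeas G (rclass R D L @^-1` A).
Proof. by []. Qed.

Lemma graphing_law_is_law : is_law G graphing_law.
Proof. by move=> r a _; rewrite graphing_lawE leaf_class_cylinder. Qed.

(** The balls of a given radius in the leafgraph belong to finitely many
    classes. Their cylinders therefore carry the whole mass of every law, and
    no mass is left for unions of other cylinders, however many there are. *)
Lemma law_unique (P : probability (Gr_borel R D) R) : is_law G P ->
  forall A, measurable A -> P A = graphing_law A.
Proof.
move=> Pl A mA; apply: (@measure_unique _ _ (Gr_borel R D)
    [set A | exists s, determined (@Gr_agree R D) s A] (fun=> setT)) mA => //.
- exact: Gr_borel_determined.
- exact: Gr_setI_closed.
- by move=> _; exists 0%N.
- by rewrite bigcup_const//; exists 0%N.
- move=> {}A [r rA]; have [xs xsP] := finite_word_patterns G r.+1.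
  pose s := [seq rclass R D (gball L x r) x | x <- xs].
  have mU := determined_measurable (@determined_cylinders R D r s).
  have PQ B := @measure_cylinders _ _ P graphing_law r s _ B.
  have {}PQ B : determined (@Gr_agree R D) r B ->
      P (cylinders r s `&` B) = graphing_law (cylinders r s `&` B).
    apply: PQ => _ /mapP[x xxs ->].
    have xr : is_rball r (rclass R D (gball L x r) x).
      exact: rclass_gball_rball.
    by rewrite Pl// graphing_law_is_law.
  have QU : graphing_law (cylinders r s) = 1%E.
    rewrite graphing_lawE (_ : _ @^-1` _ = setT) ?probability_setT//.
    apply/seteqP; split=> // y _; have [x xxs xy] := xsP y.
    exists (rclass R D (gball L x r) x); first exact: map_f.
    apply: determined_cylinder (leaf_class_agree xy) _.
    suff : (rclass R D L @^-1` cylinder r (rclass R D (gball L x r) x)) x by [].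
    by rewrite leaf_class_cylinder; exact: rclass_gballP.
  have PU : P (cylinders r s) = 1%E.
    by rewrite -[cylinders r s]setIT PQ// setIT.
  have mA := determined_measurable rA.
  apply: etrans (esym (probability_setI1 mU mA PU)) _.
  by apply: etrans (PQ _ rA) _; exact: probability_setI1.
- by move=> _; exact: le_lt_trans (probability_le1 P measurableT) (ltry 1).
Qed.

End law.

(** * Unimodularity *)

Section unimodularity_of_the_law.
Variables (R : realType) (d : measure_display) (X : measurableType d).
Variables (k : nat) (G : graphing R X k) (D : nat) (D0 : (0 < D)%N).
Hypothesis LD : max_degree_le (leafgraph G) D.

Local Notation L := (leafgraph G).

(** Several involutions may join the same two points; an edge is attributed to
    the first of them. *)
Definition first_edge (j : 'I_k) : set X :=
  [set x | invol G j x <> x /\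
    forall l : 'I_k, (l < j)%N -> invol G l x <> invol G j x].

Lemma first_edge_adj j x : first_edge j x -> adj L x (invol G j x).
Proof. by move=> [jx _]; apply/asboolP; split; [exact: nesym|exists j]. Qed.

(** The other endpoint attributes the edge to the same involution, because two
    involutions that agree at one endpoint agree at the other. *)
Lemma first_edge_invol j x : first_edge j (invol G j x) <-> first_edge j x.
Proof.
suff sub z : first_edge j z -> first_edge j (invol G j z).
  by split=> [/sub|/sub//]; rewrite involK.
move=> [jz lj]; split; first by rewrite involK; exact: nesym.
move=> l /lj ljz; rewrite involK => lz; apply: ljz.
by rewrite -[in LHS]lz involK.
Qed.

Lemma measurable_first_edge j : measurable (first_edge j).
Proof.
apply: (@measurable_word_pattern _ _ _ _ G 1) => x y xy [jx lj]; split.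
  by move=> jy; apply: jx; apply/(xy [:: j] [::]).
by move=> l /lj ljx ljy; apply: ljx; apply/(xy [:: l] [:: j]).
Qed.

Lemma sum_leaf_nbrs (F : X -> R) x :
  \sum_(y \in nbrs L x) F y =
  \sum_(j < k) (if x \in first_edge j then F (invol G j x) else 0).
Proof.
pose s := [seq j <- enum 'I_k | x \in first_edge j].
have sE j : j \in s = (x \in first_edge j).
  by rewrite mem_filter mem_enum andbT.
rewrite (reindex_fsbig (fun j => invol G j x) [set` s]); last first.
  split.
  - by move=> j /=; rewrite sE => /set_mem; exact: first_edge_adj.
  - move=> j l /set_mem /=; rewrite sE => /set_mem[_ jP].
    move=> /set_mem /=; rewrite sE => /set_mem[_ lP] jl.
    by apply: val_inj; case: (ltngtP j l) => // [/lP|/jP]; rewrite jl.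
  - move=> y /asboolP[xy [j0 yj0]]; pose P j := invol G j x == y.
    have Pj0 : P j0 by rewrite /P yj0.
    case: (@arg_minnP _ j0 P (fun j => val j) Pj0) => j /eqP jy jmin.
    exists j => //=; rewrite sE; apply/mem_set; split; rewrite jy.
      exact: nesym.
    by move=> l lj /eqP ly; have := jmin l ly; rewrite leqNgt lj.
rewrite -fsbig_seq; last by rewrite filter_uniq// enum_uniq.
by rewrite big_filter big_enum_cond/= big_mkcond.
Qed.

Lemma measurable_first_edge_class j :
  measurable_fun (first_edge j)
    (fun x => vclass R D0 L x (invol G j x) : vGr_borel R D0).
Proof.
apply: (@measurability _ _ X (vGr_borel R D0) (first_edge j) _ _
  (vGr_borel_determined R D0)) => _ [A [s sA] <-].
(* [s.+1] for the ball that decides agreement of the edge classes up to [s], and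
   one more letter to decide adjacency inside it *)
apply: (@measurable_word_pattern _ _ _ _ G s.+2) => x y xy [jx Ax].
have xy1 : same_word_pattern G 1 x y.
  by move=> u v u1 v1; apply: xy; [exact: leq_trans u1 _|exact: leq_trans v1 _].
have jy : first_edge j y.
  case: jx => jx lj; split.
    by move=> jy; apply: jx; apply/(xy1 [:: j] [::]).
  by move=> l /lj ljx ljy; apply: ljx; apply/(xy1 [:: l] [:: j]).
split=> //; apply: sA Ax.
have [f isof fact] := word_pattern_iso xy.
have fx : f x = y := fact [::] erefl.
have fjx : f (invol G j x) = invol G j y := fact [:: j] erefl.
rewrite -fx in isof.
have [_ + _] := edge_agree R D0 LD LD (first_edge_adj jx) isof.
by rewrite fx fjx.
Qed.

Section change_of_variables.
Variable f : vGr_borel R D0 -> R.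
Hypotheses (mf : measurable_fun setT f) (f0 : forall a, 0 <= f a).

Definition edge_weight (j : 'I_k) (x : X) : R :=
  if x \in first_edge j then f (vclass R D0 L x (invol G j x)) else 0.

Lemma edge_weight_ge0 j x : 0 <= edge_weight j x.
Proof. by rewrite /edge_weight; case: ifP. Qed.

Lemma measurable_edge_weight j : measurable_fun setT (edge_weight j).
Proof.
have mEj := measurableT_comp mf (@measurable_first_edge_class j).
exact: (measurable_restrictT _ (measurable_first_edge j)).1 mEj.
Qed.

Lemma integral_edge_weight_invol j :
  (\int[gmeas G]_x (edge_weight j (invol G j x))%:E =
   \int[gmeas G]_x (edge_weight j x)%:E)%E.
Proof.
have mj := @invol_measurable _ _ _ _ G j.
transitivity (\int[pushforward (gmeas G) (invol G j)]_x (edge_weight j x)%:E)%E.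
  rewrite ge0_integral_pushforward//.
    exact/measurable_EFinP/measurable_edge_weight.
  by move=> x _; rewrite lee_fin edge_weight_ge0.
apply: eq_measure_integral => A mA _.
exact: invol_preserving.
Qed.

Lemma out_sum_edge_weights x :
  \sum_(y \in nbrs L x) f (vclass R D0 L x y) = \sum_(j < k) edge_weight j x.
Proof. by rewrite sum_leaf_nbrs. Qed.

Lemma in_sum_edge_weights x :
  \sum_(y \in nbrs L x) f (vclass R D0 L y x) =
  \sum_(j < k) edge_weight j (invol G j x).
Proof.
rewrite sum_leaf_nbrs; apply: eq_bigr => j _; rewrite /edge_weight involK.
congr (if _ then _ else _); apply/idP/idP => /set_mem jx; apply/mem_set.
  exact/first_edge_invol.
exact/first_edge_invol.
Qed.

Lemma integral_sum_edge_weights (h : 'I_k -> X -> R) :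
  (forall j, measurable_fun setT (h j)) -> (forall j x, 0 <= h j x) ->
  (\int[gmeas G]_x (\sum_(j < k) h j x)%:E =
   \sum_(j < k) \int[gmeas G]_x (h j x)%:E)%E.
Proof.
move=> mh h0; under eq_integral do rewrite -sumEFin.
rewrite ge0_integral_sum// => [j|j x _]; first exact/measurable_EFinP.
by rewrite lee_fin.
Qed.

End change_of_variables.

(** Mass transport: a sum over the neighbours splits along the involutions,
    and each of them exchanges the two endpoints of its edges while preserving
    the measure. *)
Lemma graphing_law_unimodular : unimodular D0 (graphing_law LD).
Proof.
move=> f mf f0.
rewrite /graphing_law !ge0_integral_distribution; first last.
- by move=> g; rewrite lee_fin; apply: fsumr_ge0.
- exact/measurable_EFinP/measurable_in_sum.
- by move=> g; rewrite lee_fin; apply: fsumr_ge0.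
- exact/measurable_EFinP/measurable_out_sum.
transitivity
  (\sum_(j < k) \int[gmeas G]_x (edge_weight f j (invol G j x))%:E)%E.
  rewrite -integral_sum_edge_weights; first last.
  - by move=> j x; exact: edge_weight_ge0.
  - move=> j; apply: measurableT_comp (@invol_measurable _ _ _ _ G j).
    exact: measurable_edge_weight.
  apply: eq_integral => x _ /=; congr EFin.
  by rewrite [LHS](sum_in_rclass f LD Logic.I) in_sum_edge_weights.
transitivity (\sum_(j < k) \int[gmeas G]_x (edge_weight f j x)%:E)%E.
  by apply: eq_bigr => j _; exact: integral_edge_weight_invol.
rewrite -integral_sum_edge_weights; first last.
- by move=> j x; exact: edge_weight_ge0.
- exact: measurable_edge_weight.
apply: eq_integral => x _ /=; congr EFin.
by rewrite [RHS](sum_out_rclass f LD Logic.I) out_sum_edge_weights.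
Qed.

End unimodularity_of_the_law.

Theorem corollary5p17 (R : realType) (Delta : nat) (Delta_gt0 : (0 < Delta)%N)
    (d : measure_display) (X : measurableType d) (k : nat)
    (G : graphing R X k) :
  max_degree_le (leafgraph G) Delta ->
  exists Psi : probability (Gr_borel R Delta) R,
    [/\ is_law G Psi,
        (forall P : probability (Gr_borel R Delta) R, is_law G P ->
           forall A, measurable A -> P A = Psi A) &
        unimodular Delta_gt0 Psi].
Proof.
move=> LD; exists (graphing_law LD); split.
- exact: graphing_law_is_law.
- exact: law_unique.
- exact: graphing_law_unimodular.
Qed.
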